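(* Let $X\subset\mathbb{R}^2\setminus\{0\}$ be a non-empty, compact and connected set. Then there exists a (non-constant) quasiregular mapping $f:\mathbb{R}^2\to\mathbb{R}^2$ such that, with $x_1=(1,0)$, $$X=\{\varphi(x_1):\varphi\in T(0,f)\},$$ i.e. $X$ is the image of the point evaluation map $E_{x_1}:T(0,f)\to\mathbb{R}^2$, $E_{x_1}(\varphi)=\varphi(x_1)$.
   Context: Quasiregular mapping (in dimension $2$): a continuous map $f:\mathbb{R}^2\to\mathbb{R}^2$ is quasiregular if $f\in W^{1}_{2,\mathrm{loc}}(\mathbb{R}^2)$ (first-order weak derivatives locally in $L^2$) and there is $K\in[1,\infty)$ with $|f'(x)|^2\le K J_f(x)$ for almost every $x$, where $|f'(x)|$ is the operator norm and $J_f$ is the Jacobian determinant. For a non-constant quasiregular $f:\mathbb{R}^2\to\mathbb{R}^2$ and $t>0$, put (at the base point $0$) $$f_t(x)=\frac{f(tx)-f(0)}{\rho_f(t)},\qquad \rho_f(r)=\left(\frac{\lambda[f(B(0,r))]}{\lambda[B(0,1)]}\right)^{1/2},$$ where $\lambda$ is Lebesgue measure on $\mathbb{R}^2$ and $B(0,r)$ is the Euclidean disk. A generalized derivative of $f$ at $0$ is a mapping $\varphi:\mathbb{R}^2\to\mathbb{R}^2$ of the form $\varphi=\lim_{k\to\infty}f_{t_k}$, with convergence locally uniform on $\mathbb{R}^2$, for some decreasing sequence $t_k\to0$ of positive numbers. The infinitesimal space $T(0,f)$ is the set of all generalized derivatives of $f$ at $0$. *)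

(* Defs.v *)
From mathcomp Require Import all_boot all_order all_algebra.
From mathcomp Require Import all_classical all_reals all_analysis.

Set Implicit Arguments.
Unset Strict Implicit.
Unset Printing Implicit Defensive.

Import Order.TTheory GRing.Theory Num.Theory.
Import numFieldNormedType.Exports.

Local Open Scope classical_set_scope.
Local Open Scope ring_scope.

(* The plane is [R * R].  The library norm there is the max norm; it is used
   only through the topology and uniformity it induces.  All metric notions
   (disks, operator norm) use the Euclidean norm [enorm]. *)
Definition enorm (R : realType) (x : R * R) : R :=
  Num.sqrt (x.1 ^+ 2 + x.2 ^+ 2).

Definition disk (R : realType) (r : R) : set (R * R) := [set x | enorm x < r].

Notation lebesgue2 R :=
  (@lebesgue_measure R \x @lebesgue_measure R)%E (only parsing).

Definition coord (R : realType) (x : R * R) (i : 'I_2) : R :=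
  if i == ord0 then x.1 else x.2.

Definition axis (R : realType) (j : 'I_2) : R * R :=
  if j == ord0 then (1, 0) else (0, 1).

Definition mxapp (R : realType) (A : 'M[R]_2) (h : R * R) : R * R :=
  let y := A *m \col_j coord h j in (y ord0 ord0, y ord_max ord0).

Definition opnorm (R : realType) (A : 'M[R]_2) : R :=
  sup [set enorm (mxapp A h) | h in [set h | enorm h <= 1]].

Fixpoint partials (R : realType) (s : seq 'I_2) (phi : R * R -> R)
    : R * R -> R :=
  if s is j :: s' then fun x => 'D_(axis R j) (partials s' phi) x else phi.

(* C^oo: every iterated partial derivative is differentiable (as a function of
   two variables), hence continuous. *)
Definition smooth (R : realType) (phi : R * R -> R) : Prop :=
  forall s x, differentiable (partials s phi) x.

Definition test_function (R : realType) (phi : R * R -> R) : Prop :=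
  smooth phi /\ compact (closure [set x | phi x != 0]).

Definition L2loc (R : realType) (u : R * R -> R) : Prop :=
  measurable_fun setT u /\
  forall C : set (R * R), compact C ->
    (\int[lebesgue2 R]_(x in C) ((u x) ^+ 2)%:E < +oo)%E.

Definition weak_partial (R : realType) (j : 'I_2) (u g : R * R -> R) : Prop :=
  forall phi : R * R -> R, test_function phi ->
    \int[lebesgue2 R]_(x in setT) (u x * 'D_(axis R j) phi x) =
    - \int[lebesgue2 R]_(x in setT) (g x * phi x).

(* [f] is in W^1_{2,loc} and [D] is (a representative of) its weak derivative,
   with [D x i j] the [j]-th partial derivative of the [i]-th component.  Weak
   derivatives are unique up to null sets, so the choice of [D] is immaterial
   in [quasiregular]. *)
Definition W12loc_deriv (R : realType) (f : R * R -> R * R)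
    (D : R * R -> 'M[R]_2) : Prop :=
  (forall i, L2loc (fun x => coord (f x) i)) /\
  (forall i j, L2loc (fun x => D x i j) /\
     weak_partial j (fun x => coord (f x) i) (fun x => D x i j)).

Definition quasiregular (R : realType) (f : R * R -> R * R) : Prop :=
  continuous f /\
  exists2 D : R * R -> 'M[R]_2, W12loc_deriv f D &
    exists2 K : R, 1 <= K &
      {ae lebesgue2 R, forall x, (opnorm (D x)) ^+ 2 <= K * \det (D x)}.

Definition rho (R : realType) (f : R * R -> R * R) (r : R) : R :=
  Num.sqrt (fine (lebesgue2 R (f @` disk r)) / fine (lebesgue2 R (disk 1))).

Definition rescale (R : realType) (f : R * R -> R * R) (t : R) (x : R * R)
    : R * R :=
  (rho f t)^-1 *: (f (t *: x) - f 0).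

Definition infinitesimal_space (R : realType) (f : R * R -> R * R)
    : set (R * R -> R * R) :=
  [set phi | exists t : nat -> R,
    [/\ forall k, 0 < t k,
        decreasing_seq t,
        t k @[k --> \oo] --> (0 : R) &
        {family compact, (fun k => rescale f (t k)) @ \oo --> phi}]].

(* Main.v *)
Require Import Defs.
From mathcomp Require Import all_boot all_order all_algebra.
From mathcomp Require Import all_classical all_reals all_analysis measurable_realfun.
From mathcomp Require Import ring lra.
Import Order.TTheory GRing.Theory Num.Theory.
Import numFieldNormedType.Exports.
Local Open Scope classical_set_scope.
Local Open Scope ring_scope.

(* A linear map of determinant 1 whose first column is p sends x_1 to p and
   preserves area.  Take f(x) = A(s) x with s = - log |x| and A(s) of determinant
   1, its first column running along a C^1 path p(s) that passes through finer
   and finer chains of points of X, each point of X being approached infinitely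
   often, at a speed tending to 0.  If the speed is small then f is
   quasiregular and f(B(0,r)) is exactly the ellipse A(- log r) B(0,r): for fixed
   y, the function s |-> e^s |A(s)^-1 y| is increasing.  Hence rho_f(r) = r and
   f_t(x) = A(s - log t) x.  Since the speed tends to 0, the locally uniform
   limits are the linear maps given by the cluster points of A at +oo, whose
   first columns are exactly the points of X. *)

(** * Linear images in the plane *)

Section affine.
Context {R : realType}.
Local Notation mu := (@lebesgue_measure R).

Lemma measurable_affine (k c : R) :
  measurable_fun setT (fun x : measurableTypeR R => k * x + c : measurableTypeR R).
Proof.
by apply: measurable_funD => //; exact: measurable_funM.
Qed.

Lemma lebesgue_measure_affine (k c : R) (A : set R) : 0 < k -> measurable A ->
  mu [set x | A (k * x + c)] = (k^-1%:E * mu A)%E.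
Proof.
move=> k0 mA.
have k0' : 0 <= k by exact: ltW.
suff -> : mu A = mscale (NngNum k0')
   (pushforward mu (fun x : measurableTypeR R => k * x + c : measurableTypeR R)) A.
- exact: measurable_affine.
- by move=> mf; rewrite /mscale /pushforward/= muleA -EFinM mulVf ?gt_eqF// mul1e.
move=> mf; apply: lebesgue_measure_unique => // _ [[a b]] _ <-.
transitivity (k%:E * mu [set` `](a - c) / k, (b - c) / k]%R])%E; last first.
  congr (_ * mu _)%E.
  apply/seteqP; split => x; rewrite /= !in_itv/= ltr_pdivrMr// ler_pdivlMr//;
    by rewrite ltrBlDr lerBrDr (mulrC x).
rewrite !lebesgue_measure_itv/= !lte_fin ltr_pM2r ?invr_gt0// ltrD2r.
case: ifPn => _; last by rewrite mule0.
rewrite -!EFinB -EFinM; congr EFin; field; exact: lt0r_neq0.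
Qed.

Lemma ge0_integral_affine (k : R) (F : R -> \bar R) : 0 < k ->
  measurable_fun setT F -> (forall x, 0 <= F x)%E ->
  (\int[mu]_x F (k * x)%R = k^-1%:E * \int[mu]_x F x)%E.
Proof.
move=> k0 mF F0.
have k0' : 0 <= k^-1 by rewrite invr_ge0 ltW.
pose phi := fun x : measurableTypeR R => k * x + 0 : measurableTypeR R.
transitivity (\int[mu]_(x in phi @^-1` setT) (F \o phi) x)%E.
  by rewrite preimage_setT; apply: eq_integral => x _ /=; rewrite /phi addr0.
rewrite -ge0_integral_pushforward//; last exact: measurable_affine.
rewrite -[k^-1]/((NngNum k0')%:num) -ge0_integral_mscale//.
apply: eq_measure_integral; first exact: measurable_affine.
by move=> mphi A mA _; exact: lebesgue_measure_affine.
Qed.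

Lemma lebesgue2_linear (al be ga : R) (S : set (R * R)) : 0 < al -> 0 < be ->
  measurable (S : set (measurableTypeR R * measurableTypeR R)) ->
  lebesgue2 R [set y | S (al * y.1, be * y.2 + ga * y.1)] =
  ((al * be)^-1%:E * lebesgue2 R S)%E.
Proof.
move=> al0 be0 mS; rewrite /product_measure1.
transitivity (\int[mu]_x (be^-1%:E * (mu \o xsection S) (al * x)%R))%E.
  apply: eq_integral => x _ /=.
  rewrite -(lebesgue_measure_affine be (ga * x))//; last exact: measurable_xsection.
rewrite ge0_integralZl//=; last 2 first.
- apply: (@measurableT_comp _ _ _ _ _ _ (mu \o xsection S)).
    exact: measurable_fun_xsection.
  rewrite (_ : *%R al = fun x => al * x + 0); first exact: measurable_affine.
  by apply/funext => x; rewrite addr0.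
- by rewrite lee_fin invr_ge0 ltW.
rewrite (ge0_integral_affine al (mu \o xsection S))//; last exact: measurable_fun_xsection.
by rewrite muleA -EFinM invfM mulrC.
Qed.

End affine.

Section plane_measurability.
Context {R : realType}.
Local Notation RR := (measurableTypeR R * measurableTypeR R)%type.

Lemma open_measurable2 (A : set (R * R)) : open A -> measurable (A : set RR).
Proof.
move=> oA.
pose B (q : (rat * rat) * (rat * rat)) : set (R * R) :=
  `]ratr q.1.1, ratr q.1.2[%classic `*` `]ratr q.2.1, ratr q.2.2[%classic.
rewrite (_ : A = \bigcup_q (if `[< B q `<=` A >] then B q else set0)).
  apply: countable_bigcupT_measurable => [|q].
    exact: (@countableP _ [set: (rat * rat) * (rat * rat)]).
  by case: ifPn => // _; exact: measurableX.
apply/seteqP; split => [[x1 x2] Ax|x [q _]]; last first.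
  by case: ifPn => // /asboolP; exact.
have /nbhs_ballP[e /= e0 xeA] : nbhs (x1, x2) A by exact: open_nbhs_nbhs.
have rat_near (x : R) : exists q : rat * rat,
    [/\ ratr q.1 < x, x < ratr q.2, x - e < ratr q.1 & ratr q.2 < x + e].
  have /rat_in_itvoo[q1] : x - e < x by lra.
  have /rat_in_itvoo[q2] : x < x + e by lra.
  rewrite !in_itv/= => /andP[? ?] /andP[? ?].
  by exists (q1, q2).
have [p [p1 p2 p3 p4]] := rat_near x1.
have [q [q1 q2 q3 q4]] := rat_near x2.
exists (p, q) => //; rewrite asboolT.
  by rewrite /B/= !in_itv/= p1 p2 q1 q2.
move=> [y1 y2] [] /=; rewrite !in_itv/= => /andP[? ?] /andP[? ?].
by apply: xeA; split => /=; rewrite /ball/= ltr_norml; apply/andP; split; lra.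
Qed.

Lemma closed_measurable2 (A : set (R * R)) : closed A -> measurable (A : set RR).
Proof.
by move/closed_openC/open_measurable2/measurableC; rewrite setCK.
Qed.

Lemma compact_measurable2 (A : set (R * R)) : compact A -> measurable (A : set RR).
Proof.
move=> cA; apply: closed_measurable2; apply: compact_closed cA.
exact: norm_hausdorff.
Qed.

Lemma open_continuous_measurable_fun2 (D : set (R * R)) (f : R * R -> R) :
  open D -> (forall x, D x -> {for x, continuous f}) ->
  measurable_fun (D : set RR) f.
Proof.
move=> oD cf mD; apply: (measurability _ (RGenOpens.measurableE R)).
move=> _ [_ [a [b ->] <-]]; apply: open_measurable2.
rewrite openE => x [Dx fx]; apply: filterI; first exact: open_nbhs_nbhs.
apply: cf => //; apply: open_nbhs_nbhs; split => //.
exact: mD.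
Qed.

Lemma continuous_measurable_fun2 (f : R * R -> R) :
  continuous f -> measurable_fun (setT : set RR) f.
Proof.
by move=> cf; apply: open_continuous_measurable_fun2 => [|x _]; [exact: openT|exact: cf].
Qed.

Lemma punctured_continuous_measurable_fun2 (f : R * R -> R) :
  (forall x, x != 0 -> {for x, continuous f}) -> measurable_fun (setT : set RR) f.
Proof.
move=> cf; have c0 : closed [set (0 : R * R)].
  by apply: compact_closed; [exact: norm_hausdorff|exact: compact_set1].
have m0 : measurable ([set (0 : R * R)] : set RR) by exact: closed_measurable2.
rewrite -(setUv [set (0 : R * R)]).
apply: (measurable_funU _ m0 (measurableC m0)).2.
split; first exact: measurable_fun_set1.
apply: open_continuous_measurable_fun2 => [|x /eqP]; first exact: closed_openC.
exact: cf.
Qed.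

End plane_measurability.

(** * Weak derivatives *)

Section weak_derivatives.
Context {R : realType}.
Local Notation mu := (@lebesgue_measure R).
Local Notation RR := (measurableTypeR R * measurableTypeR R)%type.

Lemma integral_product_rule_eq0 (M : R) (u g phi psi : R -> R) :
  (forall x, is_derive x (1 : R) u (g x)) -> continuous g ->
  (forall x, is_derive x (1 : R) phi (psi x)) -> continuous psi ->
  (forall x, M < `|x| -> phi x = 0 /\ psi x = 0) ->
  (\int[mu]_x (u x * psi x + g x * phi x)%:E = 0)%E.
Proof.
move=> du cg dphi cpsi supp.
pose N : R := `|M| + 1.
have N0 : 0 < N by rewrite /N ltr_wpDl.
have MN : M < N by rewrite /N; have := ler_norm M; lra.
have cu : continuous u.
  by move=> x; apply: differentiable_continuous; apply/derivable1_diffP/ex_derive.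
have cphi : continuous phi.
  by move=> x; apply: differentiable_continuous; apply/derivable1_diffP/ex_derive.
have dF x : is_derive x (1 : R) (u * phi) (u x * psi x + g x * phi x).
  apply: is_derive_eq; rewrite /= [X in _ + X]mulrC; reflexivity.
have zero x : N <= `|x| -> phi x = 0 /\ psi x = 0.
  by move=> Nx; apply: supp; exact: lt_le_trans Nx.
transitivity (\int[mu]_(x in [set` `[- N, N]%R]) (u x * psi x + g x * phi x)%:E)%E.
  rewrite [RHS]integral_mkcond; apply: eq_integral => x _.
  rewrite patchE; case: ifPn => //; rewrite notin_setE/= in_itv/= => /negP.
  rewrite -ler_norml -ltNge => /ltW/zero[-> ->].
  by rewrite !mulr0 addr0.
have cF : continuous (u * phi).
  by move=> x; apply: differentiable_continuous; apply/derivable1_diffP/ex_derive.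
rewrite (@continuous_FTC2 R _ (u * phi)).
- have [NN _] := zero N (ler_norm _).
  have [NN' _] := zero (- N) ltac:(by rewrite normrN ler_norm).
  by rewrite /GRing.mul/= NN NN' !mulr0 subee.
- by lra.
- apply: continuous_subspaceT => x.
  by apply: cvgD; apply: cvgM; [exact: cu|exact: cpsi|exact: cg|exact: cphi].
- split => [x _||]; first exact: ex_derive.
    by apply: cvg_at_right_filter; exact: cF.
  by apply: cvg_at_left_filter; exact: cF.
- by move=> x _; rewrite derive1E; exact: derive_val.
Qed.

Definition box (M : R) : set (R * R) := `[- M, M]%classic `*` `[- M, M]%classic.

Lemma compact_box (M : R) : compact (box M).
Proof. by apply: compact_setX; exact: segment_compact. Qed.

Lemma measurable_box (M : R) : measurable (box M : set RR).
Proof. by apply: compact_measurable2; exact: compact_box. Qed.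

Lemma lebesgue2_box (M : R) : (lebesgue2 R (box M) < +oo)%E.
Proof.
rewrite [ltLHS]product_measure1E//= !lebesgue_measure_itv/=.
by case: ifPn => _; rewrite ?mule0 ?ltry// -EFinB -EFinM ltry.
Qed.

Lemma compact_sub_box (C : set (R * R)) : compact C -> exists M : R, C `<=` box M.
Proof.
move=> /compact_bounded[M [_ MC]]; exists (M + 1) => -[x1 x2] Cx.
have := MC (M + 1) ltac:(by rewrite ltrDl) _ Cx.
rewrite /= [X in X <= _](_ : _ = Num.max `|x1| `|x2|)// ge_max => /andP[].
by rewrite !ler_norml => x1M x2M; split => /=; rewrite in_itv.
Qed.

Lemma bounded_box_integrable (M K : R) (h : R * R -> R) :
  measurable_fun (setT : set RR) h -> (forall x, `|h x| <= K) ->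
  (forall x, ~ box M x -> h x = 0) ->
  (lebesgue2 R).-integrable setT (EFin \o h).
Proof.
move=> mh hK h0.
have -> : EFin \o h = (EFin \o h) \_ (box M).
  apply/funext => x; rewrite patchE; case: ifPn => //.
  by rewrite notin_setE => /h0 /= ->.
apply: (integrable_mkcond _ (measurable_box M)).1.
apply: measurable_bounded_integrable.
- exact: measurable_box.
- exact: lebesgue2_box.
- exact: measurable_funTS.
- by exists K; split; [exact: num_real|move=> N KN x _ /=; rewrite (le_trans (hK x))// ltW].
Qed.

Definition line (j : 'I_2) (y x : R) : R * R := if j == ord0 then (x, y) else (y, x).

Lemma integral_lines_eq0 (j : 'I_2) (h : R * R -> R) :
  (lebesgue2 R).-integrable setT (EFin \o h) ->
  (forall y : R, y != 0 -> (\int[mu]_x (h (line j y x))%:E = 0)%E) ->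
  (\int[lebesgue2 R]_x (h x)%:E = 0)%E.
Proof.
move=> ih h0.
have integral_off0 (G : R -> \bar R) : measurable_fun setT G ->
    (forall y : R, y != 0 -> (G y = 0)%E) -> (\int[mu]_y G y = 0)%E.
  move=> mG G0; transitivity (\int[mu]_(y in setT) cst 0%E y)%E; last exact: integral0.
  apply: ae_eq_integral => //.
  exists [set 0]; split => //; first exact: lebesgue_measure_set1.
  by move=> y /= Gy; apply: contrapT => /eqP/G0 Gy0; apply: Gy => _; rewrite Gy0.
have [j0|j1] := eqVneq j ord0.
  rewrite -(integral21_prod_meas1 ih); apply: integral_off0 => [|y y0].
    exact: (measurable_fubini_G ih).
  by rewrite -[RHS](h0 y y0); apply: eq_integral => x _; rewrite /line j0 eqxx.
rewrite -(integral12_prod_meas1 ih); apply: integral_off0 => [|y y0].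
  exact: (measurable_fubini_F ih).
by rewrite -[RHS](h0 y y0); apply: eq_integral => x _; rewrite /line (negbTE j1).
Qed.

Lemma is_derive_line (j : 'I_2) (phi : R * R -> R) (y x : R) :
  differentiable phi (line j y x) ->
  is_derive x (1 : R) (phi \o line j y) ('D_(axis R j) phi (line j y x)).
Proof.
move=> dphi.
have E : (fun h : R => h^-1 *: ((phi \o line j y \o shift x) (h *: (1 : R)) -
      (phi \o line j y) x)) =
    (fun h => h^-1 *: ((phi \o shift (line j y x)) (h *: axis R j) - phi (line j y x))).
  apply/funext => h /=; congr (_ *: (phi _ - _)).
  rewrite /line /axis; case: ifPn => _; congr (_, _) => //=;
    by rewrite /GRing.scale/= mulr0 add0r.
split; last by rewrite /derive E.
rewrite /derivable E; exact: diff_derivable.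
Qed.

Lemma continuous_line (j : 'I_2) (y : R) : continuous (line j y).
Proof.
move=> x; rewrite /line; case: (j == ord0).
  exact: (@cvg_pair _ _ _ (nbhs x) (nbhs x) (nbhs y) _ _ _ id (cst y) cvg_id (cvg_cst y)).
exact: (@cvg_pair _ _ _ (nbhs x) (nbhs y) (nbhs x) _ _ _ (cst y) id (cvg_cst y) cvg_id).
Qed.

Lemma weak_partial_punctured (j : 'I_2) (u g : R * R -> R) (K : R) :
  continuous u -> (forall x, x != 0 -> {for x, continuous g}) ->
  (forall x, `|g x| <= K) ->
  (forall y x, y != 0 -> is_derive x (1 : R) (u \o line j y) (g (line j y x))) ->
  weak_partial j u g.
Proof.
move=> cu cg gK du phi [sphi csupp].
have dphi x : differentiable phi x := sphi [::] x.
have cphi : continuous phi by move=> x; exact: differentiable_continuous.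
pose psi : R * R -> R := 'D_(axis R j) phi.
have cpsi : continuous psi.
  by move=> x; apply: differentiable_continuous; exact: (sphi [:: j] x).
have [M suppM] := compact_sub_box _ csupp.
have supp x : ~ box M x -> phi x = 0 /\ psi x = 0.
  move=> Mx.
  have nx : \forall z \near x, phi z = 0.
    have : (~` closure [set x | phi x != 0]) x by move=> /suppM.
    move=> xC; have : nbhs x (~` closure [set x | phi x != 0]).
      by apply: open_nbhs_nbhs; split => //; apply: closed_openC; exact: closed_closure.
    apply: filterS => z zC; apply/eqP/negP => /negP zphi; apply: zC.
    exact: subset_closure.
  split; first exact: nbhs_singleton nx.
  rewrite /psi (near_eq_derive (g := cst 0)) ?derive_cst//.
have bounded_on_box (h : R * R -> R) : continuous h ->
    exists C, forall x, box M x -> `|h x| <= C.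
  move=> ch; have : compact (h @` box M).
    by apply: continuous_compact; [exact: continuous_subspaceT|exact: compact_box].
  move=> /compact_bounded[C [_ hC]]; exists (C + 1) => x Mx.
  by apply: (hC (C + 1)) => //; rewrite ?ltrDl//; exists x.
have mpsi := continuous_measurable_fun2 _ cpsi.
have mphi := continuous_measurable_fun2 _ cphi.
have mu' := continuous_measurable_fun2 _ cu.
have mg := punctured_continuous_measurable_fun2 _ cg.
have iupsi : (lebesgue2 R).-integrable setT (EFin \o (u \* psi)).
  have [C hC] := bounded_on_box (u \* psi) (fun x => cvgM (cu x) (cpsi x)).
  apply: (@bounded_box_integrable M (Num.max C 0)).
  - exact: measurable_funM.
  - move=> x; have [Mx|Mx] := pselect (box M x).
      by rewrite le_max (hC x Mx).
    by have [_ px] := supp x Mx; rewrite /= px mulr0 normr0 le_max lexx orbT.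
  - by move=> x /supp[_ px]; rewrite /= px mulr0.
have igphi : (lebesgue2 R).-integrable setT (EFin \o (g \* phi)).
  have [C hC] := bounded_on_box phi cphi.
  have K0 : 0 <= K by apply: le_trans (gK 0); exact: normr_ge0.
  apply: (@bounded_box_integrable M (K * (Num.max C 0))).
  - exact: measurable_funM.
  - move=> x; rewrite normrM ler_pM//; have [Mx|Mx] := pselect (box M x).
      by rewrite le_max (hC x Mx).
    by have [-> _] := supp x Mx; rewrite normr0 le_max lexx orbT.
  - by move=> x /supp[px _]; rewrite /= px mulr0.
apply/eqP; rewrite -addr_eq0 -RintegralD//; apply/eqP.
rewrite /Rintegral (@integral_lines_eq0 j)//.
  exact: (integrableD measurableT iupsi igphi).
move=> y y0; apply: (@integral_product_rule_eq0 M (u \o line j y) (g \o line j y)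
    (phi \o line j y) (psi \o line j y)).
- by move=> x; exact: du.
- move=> x; apply: continuous_comp; first exact: continuous_line.
  apply: cg; rewrite /line; case: ifPn => _; rewrite -pair_eqE/= negb_and y0//.
  by rewrite orbT.
- by move=> x; exact: is_derive_line.
- by move=> x; apply: continuous_comp; [exact: continuous_line|exact: cpsi].
- move=> x Mx; apply: supp => -[]; rewrite /line; case: ifPn => _ /=;
    by rewrite !in_itv/= -!ler_norml => ? ?; lra.
Qed.

End weak_derivatives.

(** * Recurrent chains in a continuum *)

Section chains.
Context {R : realType} {V : normedModType R}.
Implicit Types (X : set V) (e : R).

Definition near_rel e (a b : V) : bool := `|b - a| < e.

Lemma connected_chain X e (x y : V) : connected X -> 0 < e -> X x -> X y ->
  exists s : seq V, [/\ path (near_rel e) x s, last x s = y & {in s, forall z, X z}].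
Proof.
move=> cX e0 Xx; pose B := [set y | X y /\ exists s : seq V,
  [/\ path (near_rel e) x s, last x s = y & {in s, forall z, X z}]].
suff XB : X = B by move=> Xy; have [] : B y by rewrite -XB.

have step y1 y2 : B y1 -> X y2 -> `|y2 - y1| < e -> B y2.
  move=> [_ [s [ps ls sX]]] Xy2 y12; split => //; exists (rcons s y2); split.
  - by rewrite rcons_path ps ls.
  - by rewrite last_rcons.
  - by move=> z; rewrite mem_rcons inE => /predU1P[->//|]; exact: sX.
pose nbr (C : set V) := [set z | exists2 y, C y & `|z - y| < e].
have onbr (C : set V) : open (nbr C).
  rewrite openE => z [w Cw zw]; apply/nbhs_ballP; exists (e - `|z - w|) => /=.
    by rewrite subr_gt0.
  move=> t; rewrite -ball_normE/= => zt; exists w => //.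
  rewrite (_ : t - w = (z - w) - (z - t)); last by rewrite opprB [RHS]addrC addrA subrK.
  by have := ler_normB (z - w) (z - t); lra.
apply: esym; apply: cX.
- by exists x; split => //; exists [::].
- exists (nbr B) => //; apply/seteqP; split => [z Bz|z [Xz [w Bw zw]]].
    by split; [exact: Bz.1|exists z => //; rewrite subrr normr0].
  exact: step Bw Xz zw.
- exists (~` nbr (X `\` B)); first exact/open_closedC.
  apply/seteqP; split => [z Bz|z [Xz zB]].
    split; first exact: Bz.1.
    by move=> [w [Xw nBw] zw]; apply: nBw; apply: step Bz Xw _; rewrite distrC.
  by apply: contrapT => nBz; apply: zB; exists z => //; rewrite subrr normr0.
Qed.

Lemma connected_tour X e (x : V) (l : seq V) : connected X -> 0 < e -> X x ->
  {in l, forall z, X z} ->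
  exists s : seq V, [/\ path (near_rel e) x s, last x s = x,
    {in s, forall z, X z} & {subset l <= s}].
Proof.
move=> cX e0 Xx; elim: l => [|y l IH] lX; first by exists [::].
have [|s [ps ls sX lsub]] := IH; first by move=> z zl; apply: lX; rewrite inE zl orbT.
have Xy : X y by apply: lX; rewrite inE eqxx.
have [s1 [ps1 ls1 s1X]] := connected_chain _ _ _ _ cX e0 Xx Xy.
have [s2 [ps2 ls2 s2X]] := connected_chain _ _ _ _ cX e0 Xy Xx.
exists (rcons s1 y ++ (s2 ++ s)); split.
- rewrite cat_path rcons_path ps1 ls1 last_rcons cat_path ps2 ls2 ps /near_rel.
  by rewrite subrr normr0 e0.
- by rewrite !last_cat last_rcons ls2.
- move=> z; rewrite !mem_cat mem_rcons inE => /or3P[/predU1P[->//|]| |]; by auto.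
- move=> z; rewrite inE !mem_cat mem_rcons inE => /predU1P[->|/lsub ->].
    by rewrite eqxx.
  by rewrite !orbT.
Qed.

Lemma compact_net X e : compact X -> 0 < e ->
  exists l : seq V, {in l, forall z, X z} /\
    forall y, X y -> exists2 z, z \in l & `|z - y| < e.
Proof.
move=> cX e0; move: cX; rewrite compact_cover => /(_ V X (fun z => ball z e)).
case=> [z _|z Xz|D DX XD]; first exact: ball_open.
  by exists z => //; exact: ballxx.
exists (finmap.enum_fset D); split=> [z zD|y /XD[z /= zD]]; first by have := DX z zD; rewrite inE.
by rewrite -ball_normE => zy; exists z.
Qed.

Lemma recurrent_chain X e0 : X !=set0 -> compact X -> connected X -> 0 < e0 ->
  exists x : nat -> V,
    [/\ forall n, X (x n),
        forall n, `|x n.+1 - x n| < e0,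
        forall e, 0 < e -> exists N, forall n, (N <= n)%N -> `|x n.+1 - x n| < e &
        forall y, X y -> forall e N, 0 < e -> exists2 n, (N <= n)%N & `|x n - y| < e].
Proof.
move=> [x0 Xx0] cptX conX e00.
pose eps (n : nat) : R := e0 / n.+1%:R.
have eps_gt0 n : 0 < eps n by rewrite divr_gt0.
have eps_le n m : (n <= m)%N -> eps m <= eps n.
  by move=> nm; rewrite ler_pM2l// lef_pV2 ?posrE// ler_nat.
have tours n : exists s : seq V, [/\ path (near_rel (eps n)) x0 s, last x0 s = x0,
    {in s, forall z, X z}, (0 < size s)%N &
    forall y, X y -> exists2 z, z \in s & `|z - y| < eps n].
  have [l [lX lnet]] := compact_net _ _ cptX (eps_gt0 n).
  have [s [ps ls sX lsub]] := connected_tour _ _ _ _ conX (eps_gt0 n) Xx0 lX.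
  exists s; split => // [|y /lnet[z /lsub zs zy]]; last by exists z.
  have [z /lsub] := lnet _ Xx0; by case: (s).
have [L LP] := choice tours.
pose H N j := flatten [seq L i | i <- iota N j].
have HS N j : H N j.+1 = H N j ++ L (N + j)%N.
  by rewrite /H -addn1 iotaD map_cat flatten_cat/= cats0.
have HD N j : H 0%N (N + j)%N = H 0%N N ++ H N j.
  by rewrite /H iotaD map_cat flatten_cat.
have Hlast N j : last x0 (H N j) = x0.
  by elim: j => // j IH; rewrite HS last_cat IH; case: (LP (N + j)%N).
have Hpath N j : path (near_rel (eps N)) x0 (H N j).
  elim: j => // j IH; rewrite HS cat_path IH Hlast /=.
  have [p _ _ _ _] := LP (N + j)%N; apply: sub_path p => a b.
  by move=> /lt_le_trans; apply; apply: eps_le; rewrite leq_addr.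
have HX N j : {in H N j, forall z, X z}.
  elim: j => // j IH z; rewrite HS mem_cat => /orP[/IH//|].
  by have [_ _ + _ _] := LP (N + j)%N; apply.
have Hsize N j : (j <= size (H N j))%N.
  elim: j => // j IH; rewrite HS size_cat -addn1 leq_add//.
  by case: (LP (N + j)%N).
pose x k := nth x0 (x0 :: H 0%N k) k.
have xE m k : (k <= size (H 0%N m))%N -> x k = nth x0 (x0 :: H 0%N m) k.
  move=> km; rewrite /x; have [mk|mk] := leqP m k.
    by rewrite -(subnKC mk) HD -cat_cons nth_cat/= ltnS subnKC// km.
  by rewrite -(subnKC (ltnW mk)) HD -cat_cons nth_cat/= ltnS Hsize.
have close N k : (size (H 0%N N) <= k)%N -> `|x k.+1 - x k| < eps N.
  move=> Nk; pose j := k.+1.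
  have sz : (k.+1 <= size (H 0%N (N + j)))%N by rewrite (leq_trans _ (Hsize _ _))// leq_addl.
  rewrite (xE _ _ sz) (xE _ _ (ltnW sz)) HD -cat_cons lastI Hlast -cats1 -catA cat1s.
  rewrite !nth_cat size_belast !ltnNge Nk/= (leqW Nk)/= subSn//=.
  apply: (pathP x0 (Hpath N j)).
  by rewrite -(ltn_add2l (size (H 0%N N))) subnKC// -size_cat -HD.
exists x; split.
- move=> n; case: n => [|n]//; rewrite /x/=; apply: (HX 0%N n.+1); apply: mem_nth.
  exact: Hsize.
- by move=> n; have := close 0%N n (leq0n _); rewrite /eps divr1.
- move=> e e_gt0; pose N := Num.truncn (e0 / e).
  exists (size (H 0%N N)) => n /close /lt_le_trans; apply.
  rewrite /eps ler_pdivrMr// mulrC -ler_pdivrMr//; apply: ltW.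
  exact: truncnS_gt.
- move=> y Xy e N e_gt0; pose n := maxn N (Num.truncn (e0 / e)).
  have epsn : eps n < e.
    rewrite /eps ltr_pdivrMr// mulrC -ltr_pdivrMr//.
    by rewrite (lt_le_trans (truncnS_gt _))// ler_nat ltnS leq_maxr.
  have [_ _ _ _ /(_ y Xy)[z zL zy]] := LP n.
  exists (size (H 0%N n) + (index z (L n)).+1)%N.
    rewrite (leq_trans _ (leq_addr _ _))// (leq_trans _ (Hsize _ _))//.
    exact: leq_maxl.
  rewrite (xE n.+1); last by rewrite HS size_cat add0n leq_add2l index_mem.
  rewrite HS add0n addnS /= nth_cat ltnNge leq_addr/= addKn nth_index//.
  exact: lt_trans zy epsn.
Qed.

End chains.

(** * A slow path through the chain *)

Section spline.
Context {R : realType}.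

Lemma is_derive_of_quadratic_error (F : R -> R) (u D C : R) :
  0 <= C -> (\forall t \near (0 : R), `|F (u + t) - F u - D * t| <= C * t ^+ 2) ->
  is_derive u (1 : R) F D.
Proof.
move=> C0 FC.
have lim : h^-1 *: ((F \o shift u) (h *: (1 : R)) - F u) @[h --> 0^'] --> D.
  apply/cvgrPdist_le => e e0; near=> h.
  have h0 : h != 0 by near: h; exact: nbhs_dnbhs_neq.
  have hC : `|h| <= e / (C + 1).
    near: h; apply: dnbhs0_le; rewrite divr_gt0// ltr_wpDl//.
  rewrite /= /GRing.scale/= mulr1 (addrC h).
  rewrite (_ : D - _ = - (h^-1 * (F (u + h) - F u - D * h))); last by field.
  rewrite normrN normrM normfV ler_pdivrMl ?normr_gt0//.
  have hFC : `|F (u + h) - F u - D * h| <= C * h ^+ 2.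
    by near: h; exact: nbhs_dnbhs.
  apply: le_trans hFC _; rewrite -real_normK ?num_real// expr2 mulrC -mulrA.
  rewrite ler_pM2l ?normr_gt0// mulrC.
  apply: (@le_trans _ _ ((C + 1) * `|h|)).
    by rewrite ler_wpM2r// lerDl.
  by rewrite mulrC -ler_pdivlMr// ltr_wpDl.
split; first by apply/cvg_ex; exists D.
by apply: cvg_lim => //; exact: Rhausdorff.
Unshelve. all: end_near. Qed.

Definition pos (x : R) : R := Num.max x 0.

Lemma posE (x : R) : (pos x = x /\ 0 <= x) \/ (pos x = 0 /\ x < 0).
Proof. by rewrite /pos; case: (ltP x 0) => x0; [right|left]. Qed.

Lemma continuous_pos : continuous pos.
Proof. by move=> x; apply: continuous_max; [exact: cvg_id|exact: cvg_cst]. Qed.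

(* The integral of a hat function supported on [[0, 1]]. *)
Definition step (x : R) : R := 2 * (pos x ^+ 2 - 2 * pos (x - 2^-1) ^+ 2 + pos (x - 1) ^+ 2).
Definition dstep (x : R) : R := 4 * (pos x - 2 * pos (x - 2^-1) + pos (x - 1)).

Lemma step_error (x t : R) : `|step (x + t) - step x - dstep x * t| <= 8 * t ^+ 2.
Proof.
have pos_sqr y : `|pos (y + t) ^+ 2 - pos y ^+ 2 - 2 * pos y * t| <= t ^+ 2.
  rewrite ler_norml.
  by case: (posE (y + t)) => -[-> ?]; case: (posE y) => -[-> ?]; apply/andP; split; nra.
rewrite /step /dstep ![x + t - _]addrAC.
move: (pos_sqr x) (pos_sqr (x - 2^-1)) (pos_sqr (x - 1)).
by rewrite !ler_norml => /andP[? ?] /andP[? ?] /andP[? ?]; apply/andP; split; lra.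
Qed.

Lemma continuous_dstep : continuous dstep.
Proof.
have cpos (k : R) : continuous (fun x => pos (x - k)).
  move=> x; apply: (@continuous_comp _ _ _ (fun x : R => x - k) pos); last exact: continuous_pos.
  by apply: cvgB; [exact: cvg_id|exact: cvg_cst].
move=> x; apply: cvgM; first exact: cvg_cst.
apply: cvgD; last exact: cpos.
apply: cvgB; first exact: continuous_pos.
by apply: cvgM; [exact: cvg_cst|exact: cpos].
Qed.

Lemma step_le0 (x : R) : x <= 0 -> step x = 0 /\ dstep x = 0.
Proof.
rewrite /step /dstep => x0.
case: (posE x) => -[-> ?]; case: (posE (x - 2^-1)) => -[-> ?];
  by case: (posE (x - 1)) => -[-> ?]; split; nra.
Qed.

Lemma step_ge1 (x : R) : 1 <= x -> step x = 1 /\ dstep x = 0.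
Proof.
rewrite /step /dstep => x0.
case: (posE x) => -[-> ?]; case: (posE (x - 2^-1)) => -[-> ?];
  by case: (posE (x - 1)) => -[-> ?]; split; lra.
Qed.

Lemma step_bound (x : R) : 0 <= step x <= 1.
Proof.
rewrite /step.
case: (posE x) => -[-> ?]; case: (posE (x - 2^-1)) => -[-> ?];
  by case: (posE (x - 1)) => -[-> ?]; apply/andP; split; nra.
Qed.

Lemma dstep_bound (x : R) : 0 <= dstep x <= 2.
Proof.
rewrite /dstep.
case: (posE x) => -[-> ?]; case: (posE (x - 2^-1)) => -[-> ?];
  by case: (posE (x - 1)) => -[-> ?]; apply/andP; split; lra.
Qed.

Variable y : nat -> R.
Let del n := y n.+1 - y n.

Definition spline (s : R) : R :=
  y (Num.truncn s) + step (s - (Num.truncn s)%:R) * del (Num.truncn s).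
Definition dspline (s : R) : R :=
  dstep (s - (Num.truncn s)%:R) * del (Num.truncn s).

Lemma spline_sum (N : nat) (s : R) : s < N%:R ->
  spline s = y 0%N + \sum_(n < N) step (s - n%:R) * del n /\
  dspline s = \sum_(n < N) dstep (s - n%:R) * del n.
Proof.
move=> sN; rewrite /spline /dspline; set m := Num.truncn s.
have after n : (m < n)%N -> s - n%:R <= 0.
  move=> mn; rewrite subr_le0; apply: ltW.
  by rewrite (lt_le_trans (truncnS_gt s))// ler_nat.
have before n : (n < m)%N -> 1 <= s - n%:R.
  by rewrite truncn_gt_nat lerBrDr addrC natr1.
have [N0|Nm] := leqP N m.
  have m0 : m = 0%N.
    apply/eqP; rewrite -leqn0 leqNgt; apply/negP => m0.
    have := before 0%N m0; rewrite subr0 => s1.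
    have : m%:R <= s by rewrite truncn_le; lra.
    by rewrite leNgt (lt_le_trans sN)// ler_nat.
  move: N0 sN; rewrite m0 leqn0 => /eqP ->; rewrite !big_ord0 subr0 => s0.
  by have [-> ->] := step_le0 s (ltW s0); rewrite !mul0r.
split.
- rewrite -(big_mkord predT (fun n => step (s - n%:R) * del n)).
  rewrite (big_cat_nat (leq0n m) (ltnW Nm))/= (eq_big_nat _ _ (F2 := del)); last first.
    by move=> n /andP[_ nm]; have [-> _] := step_ge1 _ (before n nm); rewrite mul1r.
  rewrite telescope_sumr// big_ltn// big_nat_cond big1 ?addr0; last first.
    move=> n /andP[/andP[mn _] _]; have [-> _] := step_le0 _ (after n mn).
    by rewrite mul0r.
  by rewrite addrA subrKC.
- rewrite (bigD1 (Ordinal Nm))//= big1 ?addr0// => n nm.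
  have [nm'|mn|nm'] := ltngtP n m.
  + by have [_ ->] := step_ge1 _ (before n nm'); rewrite mul0r.
  + by have [_ ->] := step_le0 _ (after n mn); rewrite mul0r.
  + by move: nm; rewrite -val_eqE/= nm' eqxx.
Qed.

Lemma near_truncn (s : R) : \forall t \near s, t < (Num.truncn s).+2%:R.
Proof.
near=> t; near: t; apply: lt_nbhsl.
by rewrite (lt_trans (truncnS_gt s))// ltr_nat.
Unshelve. all: end_near. Qed.

Lemma is_derive_spline (s : R) : is_derive s (1 : R) spline (dspline s).
Proof.
pose N := (Num.truncn s).+2.
apply: (@is_derive_of_quadratic_error _ _ _ (\sum_(n < N) 8 * `|del n|)).
  by apply: sumr_ge0 => n _; rewrite mulr_ge0.
have near_s : \forall t \near (0 : R), s + t < N%:R.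
  have Ns : 0 < N%:R - s by rewrite subr_gt0; exact: nbhs_singleton (near_truncn s).
  apply/nbhs_ballP; exists (N%:R - s) => //= t.
  by rewrite -ball_normE/= sub0r normrN ltr_norml => /andP[_]; rewrite ltrBrDl.
apply: (filterS _ near_s) => t stN.
have [-> _] := spline_sum _ _ stN.
have [-> ->] := spline_sum _ _ (nbhs_singleton (near_truncn s)).
rewrite opprD addrACA subrr add0r -sumrB mulr_suml -sumrB mulr_suml.
apply: le_trans (ler_norm_sum _ _ _) _; apply: ler_sum => n _.
rewrite (_ : _ - _ = (step (s - n%:R + t) - step (s - n%:R) - dstep (s - n%:R) * t) * del n).
  by rewrite normrM [leRHS]mulrAC; apply: ler_wpM2r => //; exact: step_error.
by rewrite (addrAC s); ring.
Qed.

Lemma continuous_dspline : continuous dspline.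
Proof.
move=> s; pose N := (Num.truncn s).+2.
have [_ E] := spline_sum _ _ (nbhs_singleton (near_truncn s)).
rewrite /continuous_at E.
apply: cvg_trans (_ : (fun t => \sum_(n < N) dstep (t - n%:R) * del n) @ s --> _).
  apply: near_eq_cvg; apply: filterS (near_truncn s) => t /spline_sum[_ ->//].
apply: cvg_big => [|n _]; first exact: add_continuous.
apply: cvgM; last exact: cvg_cst.
apply: (@continuous_comp _ _ _ (fun t : R => t - n%:R) dstep).
  by apply: cvgB; [exact: cvg_id|exact: cvg_cst].
exact: continuous_dstep.
Qed.

Lemma splineE (n : nat) : spline n%:R = y n.
Proof.
by rewrite /spline natrK subrr; have [-> _] := step_le0 0 (lexx _); rewrite mul0r addr0.
Qed.

Lemma dist_spline (s : R) :
  `|spline s - y (Num.truncn s)| <= `|del (Num.truncn s)|.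
Proof.
rewrite /spline [y _ + _]addrC addrK normrM ler_piMl//.
by have /andP[s0 s1] := step_bound (s - (Num.truncn s)%:R); rewrite ger0_norm.
Qed.

Lemma dspline_bound (s : R) : `|dspline s| <= 2 * `|del (Num.truncn s)|.
Proof.
rewrite /dspline normrM ler_wpM2r//.
by have /andP[s0 s1] := dstep_bound (s - (Num.truncn s)%:R); rewrite ger0_norm.
Qed.

End spline.

Section slow_frames.
Context {R : realType}.

Local Notation i0 := (ord0 : 'I_2).
Local Notation i1 := (ord_max : 'I_2).

(* The last two fields say that the set of cluster points at [+oo] of the first
   column of [A] is [X]. *)
Record slow_frame (X : set (R * R)) (M delta : R) (A A' : 'I_2 -> 'I_2 -> R -> R) : Prop := {
  frame_derive : forall i j s, is_derive s (1 : R) (A i j) (A' i j s) ;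
  frame_continuous_deriv : forall i j, continuous (A' i j) ;
  frame_bound : forall i j s, `|A i j s| <= M ;
  frame_deriv_bound : forall i j s, `|A' i j s| <= delta ;
  frame_slow : forall e, 0 < e -> exists S, forall s, S <= s ->
    forall i j, `|A' i j s| <= e ;
  frame_det : forall s, A i0 i0 s * A i1 i1 s - A i0 i1 s * A i1 i0 s = 1 ;
  frame_near : forall e, 0 < e -> exists S, forall s, S <= s ->
    exists2 x, X x & `|x - (A i0 i0 s, A i1 i0 s)| < e ;
  frame_recurrent : forall x, X x -> exists (k : nat -> nat) (B : 'I_2 -> 'I_2 -> R),
    [/\ forall n, (k n < k n.+1)%N,
        forall i j, A i j (k n)%:R @[n --> \oo] --> B i j &
        (B i0 i0, B i1 i0) = x] }.

Lemma norm_pairE (x : R * R) : `|x| = Num.max `|x.1| `|x.2|.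
Proof. by []. Qed.

Lemma exists_slow_frame (X : set (R * R)) : X `<=` ~` [set 0] -> X !=set0 ->
  compact X -> connected X ->
  exists2 M : R, 0 < M & forall delta, 0 < delta ->
    exists A A', slow_frame X M delta A A'.
Proof.
move=> X0 XN cptX conX.
have [r r0 Xr] : exists2 r : R, 0 < r & forall x, X x -> r <= `|x|.
  have clX : closed X by apply: compact_closed cptX; exact: norm_hausdorff.
  have /nbhs_ballP[r /= r0 rX] : nbhs (0 : R * R) (~` X).
    by apply: open_nbhs_nbhs; split; [exact: closed_openC|move=> /X0; apply].
  exists r => // x Xx; rewrite leNgt; apply/negP => xr; apply: (rX x) => //.
  by rewrite -ball_normE/= sub0r normrN.
have [M0 M00 XM0] : exists2 M0 : R, 0 < M0 & forall x, X x -> `|x| <= M0.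
  have [N [_ NX]] := compact_bounded cptX; exists (`|N| + 1).
    by rewrite ltr_wpDl.
  by apply: NX; rewrite (le_lt_trans (ler_norm N))// ltrDl.
pose m := (r / 2) ^+ 2; pose M1 := M0 + 1.
have m0 : 0 < m by rewrite exprn_gt0// divr_gt0.
have M10 : 0 < M1 by rewrite addr_gt0.
pose C := 1 + m^-1 + 4 * M1 ^+ 2 * m^-1 ^+ 2.
have C0 : 0 < C.
  have : 0 < m^-1 by rewrite invr_gt0.
  have : 0 < 4 * M1 ^+ 2 * m^-1 ^+ 2 by rewrite !mulr_gt0 ?exprn_gt0 ?invr_gt0.
  by rewrite /C; lra.
exists (M1 + M1 / m); first by apply: addr_gt0 => //; apply: divr_gt0.
move=> delta delta0.
pose e0 := Num.min (Num.min (r / 2) 1) (delta / (2 * C)).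
have e00 : 0 < e0.
  have h1 : 0 < r / 2 by exact: divr_gt0.
  have h2 : 0 < delta / (2 * C) by apply: divr_gt0 => //; exact: mulr_gt0.
  by rewrite /e0 !lt_min h1 h2 ltr01.
have e0r : e0 <= r / 2 by rewrite /e0 !ge_min lexx.
have e01 : e0 <= 1 by rewrite /e0 !ge_min lexx orbT.
have e0d : e0 <= delta / (2 * C) by rewrite /e0 ge_min lexx orbT.
have [x [xX xstep xslow xrec]] := recurrent_chain X e0 XN cptX conX e00.
pose p := spline (fun n => (x n).1); pose q := spline (fun n => (x n).2).
pose p' := dspline (fun n => (x n).1); pose q' := dspline (fun n => (x n).2).
have dx n : `|(x n.+1).1 - (x n).1| <= `|x n.+1 - x n| /\
            `|(x n.+1).2 - (x n).2| <= `|x n.+1 - x n|.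
  by rewrite norm_pairE !le_max !lexx orbT.
have near_x s : `|x (Num.truncn s) - (p s, q s)| <= `|x (Num.truncn s).+1 - x (Num.truncn s)|.
  have [d1 d2] := dx (Num.truncn s).
  rewrite norm_pairE ge_max /=; apply/andP; split; rewrite distrC.
    exact: le_trans (dist_spline _ _) d1.
  exact: le_trans (dist_spline _ _) d2.
have speed s : `|p' s| <= 2 * `|x (Num.truncn s).+1 - x (Num.truncn s)| /\
               `|q' s| <= 2 * `|x (Num.truncn s).+1 - x (Num.truncn s)|.
  have [d1 d2] := dx (Num.truncn s).
  by split; apply: le_trans (dspline_bound _ _) _; rewrite ler_pM2l.
have pq_bound s : `|p s| <= M1 /\ `|q s| <= M1.
  have := near_x s; have := xstep (Num.truncn s); have := XM0 _ (xX (Num.truncn s)).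
  rewrite norm_pairE ge_max => /andP[h1 h2] h3.
  move=> /le_trans/(_ (ltW h3)); rewrite norm_pairE ge_max /= => /andP[h4 h5].
  by split; move: h1 h2 h4 h5; rewrite /M1 !ler_norml => /andP[? ?] /andP[? ?]
    /andP[? ?] /andP[? ?]; apply/andP; split; lra.
pose nn s := p s ^+ 2 + q s ^+ 2.
have nn_ge s : m <= nn s.
  have h1 := Xr _ (xX (Num.truncn s)).
  have h2 := le_trans (near_x s) (ltW (xstep (Num.truncn s))).
  have : r / 2 <= `|(p s, q s)|.
    have := ler_normD (x (Num.truncn s) - (p s, q s)) (p s, q s).
    rewrite subrK; lra.
  rewrite norm_pairE le_max /= /m /nn => h3.
  rewrite -(real_normK (num_real (p s))) -(real_normK (num_real (q s))).
  have r2 : 0 <= r / 2 by rewrite divr_ge0// ltW.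
  by case/orP: h3 => h3; nra.
have nn0 s : nn s != 0 by rewrite gt_eqF// (lt_le_trans m0).
pose w (s : R) : R := (nn s)^-1.
pose w' (s : R) : R := - (2 * p s * p' s + 2 * q s * q' s) * w s ^+ 2.
have dp s : is_derive s (1 : R) p (p' s) by exact: is_derive_spline.
have dq s : is_derive s (1 : R) q (q' s) by exact: is_derive_spline.
have dw s : is_derive s (1 : R) w (w' s).
  have dnn : is_derive s (1 : R) nn (2 * p s * p' s + 2 * q s * q' s).
    by apply: is_derive_eq; rewrite /GRing.scale/=; ring.
  have := is_deriveV (nn0 s) dnn.
  by congr is_derive; rewrite /w' /w /GRing.scale/= exprVn !mulNr mulrC.
have w_bound s : 0 <= w s <= m^-1.
  rewrite invr_ge0 (le_trans (ltW m0) (nn_ge s))/= lef_pV2 ?posrE//.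
  exact: lt_le_trans m0 (nn_ge s).
pose A (i j : 'I_2) (s : R) : R :=
  if j == i0 then (if i == i0 then p s else q s)
  else if i == i0 then - (q s * w s) else p s * w s.
pose A' (i j : 'I_2) (s : R) : R :=
  if j == i0 then (if i == i0 then p' s else q' s)
  else if i == i0 then - (q' s * w s + q s * w' s) else p' s * w s + p s * w' s.
have A'_bound s eta : `|p' s| <= eta -> `|q' s| <= eta -> forall i j, `|A' i j s| <= C * eta.
  move=> hp hq.
  have eta0 : 0 <= eta := le_trans (normr_ge0 _) hp.
  have [bp bq] := pq_bound s.
  have /andP[w0 wm] := w_bound s.
  have hw : `|w s| <= m^-1 by rewrite ger0_norm.
  have prod_bound (a b c d : R) : `|a| <= M1 -> `|b| <= eta -> `|c| <= M1 -> `|d| <= eta ->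
      `|2 * a * b + 2 * c * d| <= 4 * M1 * eta.
    move=> ha hb hc hd; apply: le_trans (ler_normD _ _) _; rewrite !normrM (@ger0_norm _ 2)//.
    have := ler_pM (normr_ge0 _) (normr_ge0 _) ha hb.
    have := ler_pM (normr_ge0 _) (normr_ge0 _) hc hd.
    lra.
  have hw' : `|w' s| <= 4 * M1 * m^-1 ^+ 2 * eta.
    rewrite /w' normrM normrN normrX (ger0_norm w0).
    rewrite (_ : 4 * M1 * _ * _ = (4 * M1 * eta) * m^-1 ^+ 2); last by ring.
    rewrite ler_pM// ?exprn_ge0//; last by rewrite lerXn2r// nnegrE invr_ge0 ltW.
    exact: prod_bound.
  have gen (a a' : R) : `|a| <= M1 -> `|a'| <= eta -> `|a' * w s + a * w' s| <= C * eta.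
    move=> ha ha'; apply: le_trans (ler_normD _ _) _; rewrite (normrM a') (normrM a).
    have h1 := ler_pM (normr_ge0 _) (normr_ge0 _) ha' hw.
    have h2 := ler_pM (normr_ge0 _) (normr_ge0 _) ha hw'.
    have -> : C * eta = eta + eta * m^-1 + M1 * (4 * M1 * m^-1 ^+ 2 * eta).
      by rewrite /C; ring.
    by apply: lerD h2; apply: le_trans h1 _; rewrite lerDr.
  have C1 : eta <= C * eta.
    have h1 : 0 < m^-1 by rewrite invr_gt0.
    have h2 : 0 < 4 * M1 ^+ 2 * m^-1 ^+ 2 by rewrite !mulr_gt0 ?exprn_gt0 ?invr_gt0.
    by rewrite ler_peMl// /C; lra.
  move=> i j; rewrite /A'; case: ifP => _; case: ifP => _.
  - exact: le_trans C1.
  - exact: le_trans C1.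
  - by rewrite normrN; exact: gen.
  - exact: gen.
have cp : continuous p.
  by move=> s; apply: differentiable_continuous; apply/derivable1_diffP/ex_derive.
have cq : continuous q.
  by move=> s; apply: differentiable_continuous; apply/derivable1_diffP/ex_derive.
have cw : continuous w.
  by move=> s; apply: differentiable_continuous; apply/derivable1_diffP/ex_derive.
have cp' : continuous p' by exact: continuous_dspline.
have cq' : continuous q' by exact: continuous_dspline.
have cw' : continuous w'.
  move=> s; apply: cvgM; last by rewrite expr2; apply: cvgM; exact: cw.
  by apply: cvgN; apply: cvgD; apply: cvgM; [|exact: cp'| |exact: cq'];
    apply: cvgM; [exact: cvg_cst|exact: cp|exact: cvg_cst|exact: cq].
exists A, A'; split.
- move=> i j s; rewrite /A /A'; case: (j == i0); case: (i == i0) => //.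
  + have := is_deriveN (is_deriveM (dq s) (dw s)).
    by congr is_derive; rewrite /GRing.scale/= addrC (mulrC (w s)).
  + have := is_deriveM (dp s) (dw s).
    by congr is_derive; rewrite /GRing.scale/= addrC (mulrC (w s)).
- move=> i j; rewrite /A'; case: (j == i0); case: (i == i0) => // s.
  + by apply: cvgN; apply: cvgD; apply: cvgM;
      [exact: cq'|exact: cw|exact: cq|exact: cw'].
  + by apply: cvgD; apply: cvgM; [exact: cp'|exact: cw|exact: cp|exact: cw'].
- move=> i j s; have [bp bq] := pq_bound s.
  have /andP[w0 wm] := w_bound s.
  have hw : `|w s| <= m^-1 by rewrite ger0_norm.
  have h0 : 0 <= M1 / m by rewrite divr_ge0// ltW.
  rewrite /A; case: (j == i0); case: (i == i0).
  + lra.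
  + lra.
  + rewrite normrN normrM.
    have := ler_pM (normr_ge0 _) (normr_ge0 _) bq hw; lra.
  + rewrite normrM.
    have := ler_pM (normr_ge0 _) (normr_ge0 _) bp hw; lra.
- move=> i j s; have [h1 h2] := speed s.
  have := ltW (xstep (Num.truncn s)) => h3.
  have hd : 2 * `|x (Num.truncn s).+1 - x (Num.truncn s)| <= delta / C.
    apply: (@le_trans _ _ (2 * (delta / (2 * C)))); first by rewrite ler_pM2l// (le_trans h3).
    by rewrite le_eqVlt; apply/orP; left; apply/eqP; field; rewrite gt_eqF.
  rewrite (_ : delta = C * (delta / C)); last by field; rewrite gt_eqF.
  by apply: A'_bound; [exact: le_trans hd|exact: le_trans hd].
- move=> e e_gt0.
  have [|N NP] := xslow (e / (2 * C)); first by rewrite divr_gt0// mulr_gt0.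
  exists N%:R => s Ns i j.
  have s0 : 0 <= s by exact: le_trans Ns.
  have := ltW (NP (Num.truncn s) ltac:(by rewrite truncn_ge_nat)) => h3.
  have hd : 2 * `|x (Num.truncn s).+1 - x (Num.truncn s)| <= e / C.
    apply: (@le_trans _ _ (2 * (e / (2 * C)))); first by rewrite ler_pM2l.
    by rewrite le_eqVlt; apply/orP; left; apply/eqP; field; rewrite gt_eqF.
  rewrite (_ : e = C * (e / C)); last by field; rewrite gt_eqF.
  by have [h1 h2] := speed s; apply: A'_bound; [exact: le_trans hd|exact: le_trans hd].
- move=> s; rewrite /A/=; transitivity (nn s * w s); last exact: mulfV.
  by rewrite /nn; ring.
- move=> e e_gt0; have [N NP] := xslow e e_gt0.
  exists N%:R => s Ns; exists (x (Num.truncn s)) => //.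
  apply: le_lt_trans (near_x s) _; apply: NP; rewrite truncn_ge_nat//.
  exact: le_trans Ns.
- move=> y Xy.
  have /choice[f fP] (Nn : nat * nat) : exists n,
      (Nn.1 <= n)%N /\ `|x n - y| < Nn.2.+1%:R^-1.
    by have [|n nN ny] := xrec y Xy Nn.2.+1%:R^-1 Nn.1; [rewrite invr_gt0|exists n].
  pose k := fix k n := if n is n'.+1 then f ((k n').+1, n) else f (0%N, 0%N).
  have kP n : `|x (k n) - y| < n.+1%:R^-1 by case: n => [|n]; exact: (fP (_, _)).2.
  have xk : x (k n) @[n --> \oo] --> y.
    apply/cvgrPdist_lt => e e_gt0.
    apply: filterS (near_infty_natSinv_lt (PosNum e_gt0)) => n ne.
    by rewrite distrC; exact: lt_trans (kP n) ne.
  have ny0 : y.1 ^+ 2 + y.2 ^+ 2 != 0.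
    apply/negP => /eqP/eqP; rewrite paddr_eq0 ?sqr_ge0// !sqrf_eq0 => /andP[/eqP y1 /eqP y2].
    by apply: (X0 y Xy) => /=; rewrite (surjective_pairing y) y1 y2.
  have xk1 : p (k n)%:R @[n --> \oo] --> y.1.
    have -> : (fun n => p (k n)%:R) = fst \o (fun n => x (k n)).
      by apply/funext => n; exact: splineE.
    by move: xk; rewrite (surjective_pairing y) => /cvg_comp; apply; exact: cvg_fst.
  have xk2 : q (k n)%:R @[n --> \oo] --> y.2.
    have -> : (fun n => q (k n)%:R) = snd \o (fun n => x (k n)).
      by apply/funext => n; exact: splineE.
    by move: xk; rewrite (surjective_pairing y) => /cvg_comp; apply; exact: cvg_snd.
  pose wy := (y.1 ^+ 2 + y.2 ^+ 2)^-1.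
  have wk : w (k n)%:R @[n --> \oo] --> wy.
    by apply: cvgV => //; apply: cvgD; rewrite expr2; under eq_fun do rewrite expr2;
      apply: cvgM.
  exists k, (fun i j => if j == i0 then (if i == i0 then y.1 else y.2)
    else if i == i0 then - (y.2 * wy) else y.1 * wy); split.
  + by move=> n; exact: (fP ((k n).+1, n.+1)).1.
  + move=> i j; rewrite /A; case: (j == i0); case: (i == i0) => //.
      by apply: cvgN; apply: cvgM.
    by apply: cvgM.
  + by case: (y).
Qed.

End slow_frames.

Arguments frame_derive {R X M delta A A'}.
Arguments frame_bound {R X M delta A A'}.
Arguments frame_deriv_bound {R X M delta A A'}.
Arguments frame_slow {R X M delta A A'}.
Arguments frame_det {R X M delta A A'}.
Arguments frame_near {R X M delta A A'}.
Arguments frame_recurrent {R X M delta A A'}.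

(** * The spiral map *)

Section two_by_two.
Context {R : realType}.

Lemma ord2P (i : 'I_2) : i = ord0 \/ i = ord_max.
Proof. by case: i => -[|[|]]// ?; [left|right]; exact: val_inj. Qed.

Lemma det2 (D : 'M[R]_2) :
  \det D = D ord0 ord0 * D ord_max ord_max - D ord0 ord_max * D ord_max ord0.
Proof.
rewrite (expand_det_row _ ord0) !big_ord_recl big_ord0 addr0 /cofactor !det_mx11 !mxE/=.
rewrite (_ : lift ord0 ord0 = ord_max :> 'I_2); last exact: val_inj.
rewrite (_ : lift ord_max ord0 = ord0 :> 'I_2); last exact: val_inj.
by rewrite /bump/= expr0 expr1 !mul1r mulN1r mulrN.
Qed.

Lemma mxappE (D : 'M[R]_2) (h : R * R) : mxapp D h =
  (D ord0 ord0 * h.1 + D ord0 ord_max * h.2,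
   D ord_max ord0 * h.1 + D ord_max ord_max * h.2).
Proof.
have sumE (i : 'I_2) : (D *m \col_j Defs.coord h j) i ord0 = D i ord0 * h.1 + D i ord_max * h.2.
  rewrite mxE !big_ord_recl big_ord0 addr0 !mxE /Defs.coord/=; congr (_ + D i _ * _).
  exact: val_inj.
by rewrite /mxapp !sumE.
Qed.

Lemma opnorm_le (D : 'M[R]_2) (L : R) : (forall i j, `|D i j| <= L) ->
  opnorm D ^+ 2 <= 4 * L ^+ 2.
Proof.
move=> DL; have L0 : 0 <= L := le_trans (normr_ge0 _) (DL ord0 ord0).
pose S := [set enorm (mxapp D h) | h in [set h | enorm h <= 1]].
have S0 : S 0.
  exists 0; first by rewrite /enorm/= expr0n addr0 sqrtr0.
  by rewrite mxappE/= !mulr0 addr0 /enorm/= expr0n addr0 sqrtr0.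
have Sub : ubound S (2 * L).
  move=> _ [h /= h1 <-]; rewrite mxappE.
  have hsq : h.1 ^+ 2 + h.2 ^+ 2 <= 1.
    move: h1; rewrite /enorm => h1; rewrite -[leLHS]sqr_sqrtr ?addr_ge0 ?sqr_ge0//.
    by rewrite -[leRHS](expr1n _ 2) lerXn2r// nnegrE// sqrtr_ge0.
  have row (i : 'I_2) : (D i ord0 * h.1 + D i ord_max * h.2) ^+ 2 <= 2 * L ^+ 2.
    have b0 : D i ord0 ^+ 2 <= L ^+ 2.
      by rewrite -(real_normK (num_real (D i ord0))) lerXn2r// nnegrE.
    have b1 : D i ord_max ^+ 2 <= L ^+ 2.
      by rewrite -(real_normK (num_real (D i ord_max))) lerXn2r// nnegrE.
    apply: (@le_trans _ _ ((D i ord0 ^+ 2 + D i ord_max ^+ 2) * (h.1 ^+ 2 + h.2 ^+ 2))).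
      rewrite -subr_ge0 (_ : _ - _ = (D i ord0 * h.2 - D i ord_max * h.1) ^+ 2); last by ring.
      exact: sqr_ge0.
    apply: (@le_trans _ _ (2 * L ^+ 2 * 1)); last by rewrite mulr1.
    by apply: ler_pM => //; rewrite ?addr_ge0 ?sqr_ge0//; lra.
  have -> : 2 * L = Num.sqrt (4 * L ^+ 2).
    rewrite (_ : 4 * L ^+ 2 = (2 * L) ^+ 2); last by ring.
    by rewrite sqrtr_sqr ger0_norm// mulr_ge0.
  rewrite /enorm ler_sqrt/=; last by rewrite mulr_ge0// sqr_ge0.
  by have := row ord0; have := row ord_max; lra.
have o0 : 0 <= opnorm D by apply: ub_le_sup => //; exists (2 * L).
have oL : opnorm D <= 2 * L by apply: ge_sup => //; exists 0.
by rewrite (_ : 4 * L ^+ 2 = (2 * L) ^+ 2); [rewrite lerXn2r// nnegrE mulr_ge0|ring].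
Qed.

Lemma L2loc_bounded (u : R * R -> R) :
  measurable_fun (setT : set (measurableTypeR R * measurableTypeR R)) u ->
  (forall C, compact C -> exists K, forall x, C x -> `|u x| <= K) -> L2loc u.
Proof.
move=> mu_ ub; split => // C cC; have [K uK] := ub C cC.
have mC := compact_measurable2 _ cC.
apply: (@le_lt_trans _ _ (\int[lebesgue2 R]_(x in C) cst (K ^+ 2)%:E x)%E).
  apply: ge0_le_integral => //.
  - by move=> x _; rewrite lee_fin sqr_ge0.
  - by apply: measurable_funTS; apply/measurable_EFinP; exact: measurable_funX.
  - move=> x Cx; rewrite lee_fin -(real_normK (num_real (u x))).
    by rewrite lerXn2r// ?nnegrE// ?uK// (le_trans _ (uK x Cx)).
rewrite integral_cst//.
have [M CM] := compact_sub_box _ cC.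
apply: lte_mul_pinfty => //; first by rewrite lee_fin sqr_ge0.
apply: le_lt_trans (lebesgue2_box M).
by apply: le_measure => //; rewrite inE//; exact: measurable_box.
Qed.

End two_by_two.

Section spiral_map.
Context {R : realType}.
Implicit Types (x : R * R) (A : 'I_2 -> 'I_2 -> R -> R).

Local Notation i0 := (ord0 : 'I_2).
Local Notation i1 := (ord_max : 'I_2).

Definition sqnorm x : R := x.1 ^+ 2 + x.2 ^+ 2.

(* [logr x = - ln |x|], with the junk value [0] at the origin. *)
Definition logr x : R := - (ln (sqnorm x) / 2).

Definition spiral_coord A (i : 'I_2) x : R :=
  A i i0 (logr x) * x.1 + A i i1 (logr x) * x.2.

Definition spiral A x : R * R := (spiral_coord A i0 x, spiral_coord A i1 x).

(* The chain rule with [grad (logr x) = - x / |x|^2]. *)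
Definition spiral_deriv A (A' : 'I_2 -> 'I_2 -> R -> R) (i j : 'I_2) x : R :=
  A i j (logr x) - spiral_coord A' i x * (Defs.coord x j / sqnorm x).

Lemma sqnorm_gt0 x : x != 0 -> 0 < sqnorm x.
Proof.
move=> x0; rewrite lt_def addr_ge0 ?sqr_ge0// andbT; apply: contra x0.
rewrite paddr_eq0 ?sqr_ge0// !sqrf_eq0 => /andP[/eqP h1 /eqP h2].
by rewrite (surjective_pairing x) h1 h2.
Qed.

Lemma sqnorm_ge0 x : 0 <= sqnorm x.
Proof. by rewrite addr_ge0 ?sqr_ge0. Qed.

Lemma continuous_fst2 : continuous (fun x : R * R => x.1).
Proof. by move=> [a b]; exact: cvg_fst. Qed.

Lemma continuous_snd2 : continuous (fun x : R * R => x.2).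
Proof. by move=> [a b]; exact: cvg_snd. Qed.

Lemma continuous_sqnorm : continuous sqnorm.
Proof.
move=> x; rewrite /sqnorm.
by apply: cvgD; rewrite expr2; under eq_fun do rewrite expr2;
  apply: cvgM; do ?[exact: continuous_fst2|exact: continuous_snd2].
Qed.

Lemma continuous_logr x : x != 0 -> {for x, continuous logr}.
Proof.
move=> x0; have cl : {for x, continuous (@ln R \o sqnorm)}.
  apply: continuous_comp; first exact: continuous_sqnorm.
  by apply: continuous_ln; exact: sqnorm_gt0.
exact: (cvgN (cvgM cl (cvg_cst _))).
Qed.

Lemma continuous_spiral_coord A i x : (forall j, continuous (A i j)) -> x != 0 ->
  {for x, continuous (spiral_coord A i)}.
Proof.
move=> cA x0; have cAl j : {for x, continuous (fun z => A i j (logr z))}.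
  by apply: (@continuous_comp _ _ _ logr (A i j)); [exact: continuous_logr|exact: cA].
apply: cvgD; apply: cvgM; do ?[exact: cAl|exact: continuous_fst2|exact: continuous_snd2].
Qed.

Lemma spiral_coord_bound A i x (M : R) : (forall j s, `|A i j s| <= M) ->
  `|spiral_coord A i x| <= 2 * M * `|x|.
Proof.
move=> AM; apply: le_trans (ler_normD _ _) _; rewrite !normrM.
have x1 : `|x.1| <= `|x| by rewrite norm_pairE le_max lexx.
have x2 : `|x.2| <= `|x| by rewrite norm_pairE le_max lexx orbT.
have := ler_pM (normr_ge0 _) (normr_ge0 _) (AM i0 (logr x)) x1.
have := ler_pM (normr_ge0 _) (normr_ge0 _) (AM i1 (logr x)) x2.
lra.
Qed.

Lemma continuous_spiral_coord0 A i (M : R) : (forall j s, `|A i j s| <= M) ->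
  {for 0, continuous (spiral_coord A i)}.
Proof.
move=> AM; have M0 : 0 <= M := le_trans (normr_ge0 _) (AM i0 0).
have E0 : spiral_coord A i 0 = 0 by rewrite /spiral_coord/= !mulr0 addr0.
apply/cvgrPdist_le => e e0; rewrite E0.
have : \forall x \near (0 : R * R), `|x| <= e / (2 * M + 1).
  by apply: nbhs0_le; rewrite divr_gt0// ltr_wpDl// mulr_ge0.
apply: filterS => x xe; rewrite sub0r normrN.
apply: le_trans (spiral_coord_bound _ _ _ _ AM) _.
apply: (@le_trans _ _ ((2 * M + 1) * `|x|)); first by rewrite ler_wpM2r// lerDl.
by rewrite mulrC -ler_pdivlMr// ltr_wpDl// mulr_ge0.
Qed.

Lemma continuous_coord j : continuous (fun x : R * R => Defs.coord x j).
Proof.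
move=> x; rewrite /Defs.coord; case: (j == i0).
  exact: continuous_fst2.
exact: continuous_snd2.
Qed.

Lemma continuous_spiral_deriv A (A' : 'I_2 -> 'I_2 -> R -> R) i j x :
  (forall j, continuous (A i j)) ->
  (forall j, continuous (A' i j)) -> x != 0 ->
  {for x, continuous (spiral_deriv A A' i j)}.
Proof.
move=> cA cA' x0; apply: cvgB.
  by apply: (@continuous_comp _ _ _ logr (A i j)); [exact: continuous_logr|exact: cA].
apply: cvgM; first exact: continuous_spiral_coord.
apply: cvgM; first exact: continuous_coord.
by apply: cvgV; [rewrite gt_eqF// sqnorm_gt0|exact: continuous_sqnorm].
Qed.

Lemma spiral_coord_ratio_bound (A' : 'I_2 -> 'I_2 -> R -> R) i j x (delta : R) :
  (forall j s, `|A' i j s| <= delta) ->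
  `|spiral_coord A' i x * (Defs.coord x j / sqnorm x)| <= 2 * delta.
Proof.
move=> Ad; have d0 : 0 <= delta := le_trans (normr_ge0 _) (Ad i0 0).
have [->|x0] := eqVneq x 0.
  by rewrite /spiral_coord/= !mulr0 addr0 mul0r normr0 mulr_ge0.
have s0 := sqnorm_gt0 x x0.
rewrite mulrA normrM normfV (gtr0_norm s0) ler_pdivrMr// normrM.
have h1 : `|spiral_coord A' i x| <= delta * (`|x.1| + `|x.2|).
  apply: le_trans (ler_normD _ _) _; rewrite !normrM mulrDr.
  by apply: lerD; apply: ler_pM.
apply: (@le_trans _ _ (delta * (`|x.1| + `|x.2|) * `|Defs.coord x j|)).
  by rewrite ler_wpM2r.
rewrite -mulrA (_ : 2 * delta * _ = delta * (2 * sqnorm x)); last by ring.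
have -> : sqnorm x = `|x.1| ^+ 2 + `|x.2| ^+ 2 by rewrite /sqnorm !real_normK// num_real.
apply: ler_wpM2l => //.
by rewrite /Defs.coord; case: (j == i0); have := normr_ge0 x.1; have := normr_ge0 x.2; nra.
Qed.

Lemma is_derive_spiral_coord A (A' : 'I_2 -> 'I_2 -> R -> R) i j (y t : R) :
  (forall j s, is_derive s (1 : R) (A i j) (A' i j s)) -> y != 0 ->
  is_derive t (1 : R) (spiral_coord A i \o line j y) (spiral_deriv A A' i j (line j y t)).
Proof.
move=> dA y0.
have sE u : sqnorm (line j y u) = u ^+ 2 + y ^+ 2.
  by rewrite /sqnorm /line; case: (j == i0) => //=; rewrite addrC.
have s0 u : 0 < u ^+ 2 + y ^+ 2 by rewrite ltr_wpDl ?sqr_ge0// exprn_even_gt0.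
have dl : is_derive t (1 : R) (logr \o line j y) (- (t / (t ^+ 2 + y ^+ 2))).
  have -> : logr \o line j y = fun u => - (ln (u ^+ 2 + y ^+ 2) / 2).
    by apply/funext => u; rewrite /= /logr sE.
  have dsq : is_derive t (1 : R) (fun u : R => u ^+ 2 + y ^+ 2) (2 * t).
    by apply: is_derive_eq; rewrite /GRing.scale/=; ring.
  have dln := @is_derive1_comp R (@ln R) (fun u => u ^+ 2 + y ^+ 2) t _ _
    (is_derive1_ln (s0 t)) dsq.
  have := is_deriveN (is_deriveM dln (is_derive_cst (2^-1 : R) t (1 : R))).
  congr is_derive; rewrite /GRing.scale/=; field.
  by rewrite gt_eqF.
have dAl k : is_derive t (1 : R) (fun u => A i k (logr (line j y u)))
    (A' i k (logr (line j y t)) * - (t / (t ^+ 2 + y ^+ 2))).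
  exact: (@is_derive1_comp R (A i k) (logr \o line j y) t _ _ (dA k _) dl).
have -> : spiral_coord A i \o line j y =
    (fun u => A i j (logr (line j y u))) * id +
    (fun u => A i (if j == i0 then i1 else i0) (logr (line j y u))) * cst y.
  apply/funext => u; rewrite /= /spiral_coord.
  by case: (ord2P j) => ->; rewrite /line/= //= addrC.
apply: is_derive_eq.
rewrite /spiral_deriv /spiral_coord sE /GRing.scale/=.
by case: (ord2P j) => ->; rewrite /line /Defs.coord/=; ring.
Qed.


Lemma quasiregular_spiral A (A' : 'I_2 -> 'I_2 -> R -> R) (X : set (R * R)) (M delta : R) :
  0 < M -> delta <= 1 -> 16 * (M * delta) <= 1 -> slow_frame X M delta A A' ->
  quasiregular (spiral A).
Proof.
move=> M0 delta1 Mdelta H.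
have [dA cA' AM Ad _ detA _ _] := H.
have delta0 : 0 <= delta := le_trans (normr_ge0 _) (Ad i0 i0 0).
have cA i j : continuous (A i j).
  by move=> s; apply: differentiable_continuous; apply/derivable1_diffP; apply: ex_derive.
have coordE i x : Defs.coord (spiral A x) i = spiral_coord A i x.
  by case: (ord2P i) => ->.
have cS i : continuous (spiral_coord A i).
  move=> x; have [->|x0] := eqVneq x 0.
    exact: (@continuous_spiral_coord0 _ _ M).
  exact: continuous_spiral_coord.
pose L := M + 2 * delta.
have DL i j x : `|spiral_deriv A A' i j x| <= L.
  apply: le_trans (ler_normB _ _) _; apply: lerD; first exact: AM.
  exact: spiral_coord_ratio_bound.
have mD i j := punctured_continuous_measurable_fun2 _
  (fun x => continuous_spiral_deriv A A' i j x (cA i) (cA' i)).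
split.
  by move=> x; apply: (cvg_pair (cS i0 x) (cS i1 x)).
exists (fun x => \matrix_(i, j) spiral_deriv A A' i j x).
  split=> [i|i j].
    rewrite (_ : (fun x => _) = spiral_coord A i); last by apply/funext => x; exact: coordE.
    apply: L2loc_bounded => [|C cC]; first exact: continuous_measurable_fun2.
    have [K CK] := compact_sub_box _ cC.
    exists (2 * M * K) => x /CK[]; rewrite /= !in_itv/= -!ler_norml => x1 x2.
    apply: le_trans (spiral_coord_bound A i x M (AM i)) _.
    apply: ler_wpM2l; first by rewrite mulr_ge0// ltW.
    by rewrite norm_pairE ge_max x1 x2.
  rewrite (_ : (fun x => (\matrix_(i, j) _) i j) = spiral_deriv A A' i j); last first.
    by apply/funext => x; rewrite mxE.
  rewrite (_ : (fun x => _) = spiral_coord A i); last by apply/funext => x; exact: coordE.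
  split; first by apply: L2loc_bounded => // C _; exists L.
  apply: (weak_partial_punctured j _ _ L) => //.
    by move=> x x0; exact: continuous_spiral_deriv.
  by move=> y t y0; exact: is_derive_spiral_coord.
pose K := Num.max 1 (8 * L ^+ 2).
exists K; first by rewrite le_max lexx.
apply: aeW => x; set D := \matrix_(_, _) _.
have opD : opnorm D ^+ 2 <= 4 * L ^+ 2 by apply: opnorm_le => i j; rewrite mxE.
have detD : 2^-1 <= \det D.
  rewrite det2 !mxE /spiral_deriv; have := detA (logr x).
  set s := logr x => detAs.
  pose e i j := spiral_coord A' i x * (Defs.coord x j / sqnorm x).
  have Ae i j k l : `|A i j s * e k l| <= 2 * (M * delta).
    rewrite normrM (_ : 2 * (M * delta) = M * (2 * delta)); last by ring.
    by apply: ler_pM => //; exact: spiral_coord_ratio_bound.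
  rewrite -/(e i0 i0) -/(e i1 i1) -/(e i0 i1) -/(e i1 i0).
  have ee : e i0 i0 * e i1 i1 = e i0 i1 * e i1 i0 by rewrite /e; ring.
  have := Ae i0 i0 i1 i1; have := Ae i1 i1 i0 i0; have := Ae i0 i1 i1 i0; have := Ae i1 i0 i0 i1.
  rewrite !ler_norml => /andP[? ?] /andP[? ?] /andP[? ?] /andP[? ?].
  rewrite !mulrBl !mulrBr; lra.
apply: le_trans opD _.
apply: (@le_trans _ _ (K * 2^-1)).
  have : 8 * L ^+ 2 <= K by rewrite le_max lexx orbT.
  lra.
by rewrite ler_wpM2l// le_max ler01.
Qed.

End spiral_map.

(** * Images of disks and generalized derivatives *)

Section disk_image.
Context {R : realType}.
Local Notation i0 := (ord0 : 'I_2).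
Local Notation i1 := (ord_max : 'I_2).
Context (X : set (R * R)) (M delta : R) (A A' : 'I_2 -> 'I_2 -> R -> R).
Context (M0 : 0 < M) (Mdelta : 16 * (M * delta) <= 1) (HA : slow_frame X M delta A A').

Lemma disk_sqnorm (r : R) (x : R * R) : 0 < r -> disk r x <-> sqnorm x < r ^+ 2.
Proof.
move=> r0; rewrite /disk/= /enorm -/(sqnorm x) -{1}(ger0_norm (ltW r0)) -sqrtr_sqr.
by rewrite ltr_sqrt ?exprn_gt0.
Qed.

Lemma expR_logr (x : R * R) : x != 0 -> expR (logr x) ^+ 2 * sqnorm x = 1.
Proof.
move=> /sqnorm_gt0 s0; rewrite /logr -expRM_natl.
rewrite (_ : 2%:R * _ = - ln (sqnorm x)); last by field.
by rewrite expRN lnK ?posrE// mulVf// gt_eqF.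
Qed.

Lemma logr_expR (x : R * R) (s : R) : expR s ^+ 2 * sqnorm x = 1 -> logr x = s.
Proof.
move=> h; rewrite /logr; have -> : sqnorm x = expR (- (2 * s)).
  rewrite expRN expRM_natl; apply: (mulfI (_ : expR s ^+ 2 != 0)).
    by rewrite expf_neq0// gt_eqF// expR_gt0.
  by rewrite h mulfV// expf_neq0// gt_eqF// expR_gt0.
by rewrite expRK; field.
Qed.

(* The inverse matrix of [A s], which has determinant 1, applied to [y]. *)
Definition frame_inv (s : R) (y : R * R) : R * R :=
  (A i1 i1 s * y.1 - A i0 i1 s * y.2, A i0 i0 s * y.2 - A i1 i0 s * y.1).

Definition rescaled_inv_norm (y : R * R) (s : R) : R :=
  sqnorm (frame_inv s y) * expR s ^+ 2.

Lemma frame_invK (s : R) (y : R * R) :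
  A i0 i0 s * (frame_inv s y).1 + A i0 i1 s * (frame_inv s y).2 = y.1 /\
  A i1 i0 s * (frame_inv s y).1 + A i1 i1 s * (frame_inv s y).2 = y.2.
Proof.
have d := frame_det HA s; split; rewrite /frame_inv/=.
  by rewrite -[RHS]mulr1 -d; ring.
by rewrite -[RHS]mulr1 -d; ring.
Qed.

Lemma frame_inv_spiral (x : R * R) : frame_inv (logr x) (spiral A x) = x.
Proof.
have d := frame_det HA (logr x).
rewrite [RHS]surjective_pairing /frame_inv /spiral /spiral_coord/=; congr (_, _).
  by rewrite -[RHS]mulr1 -d; ring.
by rewrite -[RHS]mulr1 -d; ring.
Qed.

Lemma sqnorm_le_inv (s : R) (y : R * R) :
  sqnorm y <= 4 * M ^+ 2 * sqnorm (frame_inv s y).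
Proof.
have [h1 h2] := frame_invK s y.
set w := frame_inv s y in h1 h2 *.
have sq (a b : R) : `|a| <= M -> `|b| <= M ->
    (a * w.1 + b * w.2) ^+ 2 <= 2 * M ^+ 2 * sqnorm w.
  move=> aM bM.
  have a2 : a ^+ 2 <= M ^+ 2.
    by rewrite -(real_normK (num_real a)) lerXn2r// nnegrE// ltW.
  have b2 : b ^+ 2 <= M ^+ 2.
    by rewrite -(real_normK (num_real b)) lerXn2r// nnegrE// ltW.
  apply: (@le_trans _ _ ((a ^+ 2 + b ^+ 2) * sqnorm w)).
    rewrite -subr_ge0 (_ : _ - _ = (a * w.2 - b * w.1) ^+ 2); last by rewrite /sqnorm; ring.
    exact: sqr_ge0.
  by apply: ler_wpM2r; [exact: sqnorm_ge0|lra].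
have := sq _ _ (frame_bound HA i0 i0 s) (frame_bound HA i0 i1 s).
have := sq _ _ (frame_bound HA i1 i0 s) (frame_bound HA i1 i1 s).
rewrite h1 h2 (_ : sqnorm y = y.1 ^+ 2 + y.2 ^+ 2)//; lra.
Qed.

Definition rescaled_inv_deriv (y : R * R) (s : R) : R :=
  let w := frame_inv s y in
  2 * expR s ^+ 2 * (sqnorm w + (w.1 * (A' i1 i1 s * y.1 - A' i0 i1 s * y.2)
                               + w.2 * (A' i0 i0 s * y.2 - A' i1 i0 s * y.1))).

Lemma is_derive_rescaled_inv_norm (y : R * R) (s : R) :
  is_derive s (1 : R) (rescaled_inv_norm y) (rescaled_inv_deriv y s).
Proof.
have dA := frame_derive HA.
have dlin (a' b' c d : R) (f g : R -> R) :
    is_derive s (1 : R) f a' -> is_derive s (1 : R) g b' ->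
    is_derive s (1 : R) (fun s => f s * c - g s * d) (a' * c - b' * d).
  move=> df dg; apply: is_derive_eq; rewrite /GRing.scale/=; ring.
have d1 := dlin _ _ y.1 y.2 _ _ (dA i1 i1 s) (dA i0 i1 s).
have d2 := dlin _ _ y.2 y.1 _ _ (dA i0 i0 s) (dA i1 i0 s).
have dsq (f : R -> R) a : is_derive s (1 : R) f a ->
    is_derive s (1 : R) (fun s => f s ^+ 2) (2 * f s * a).
  by move=> df; apply: is_derive_eq; rewrite /GRing.scale/=; ring.
have d12 := is_deriveD (dsq _ _ d1) (dsq _ _ d2).
apply: (is_derive_eq (is_deriveM d12 (dsq _ _ (is_derive_expR s)))).
rewrite !fctE /rescaled_inv_deriv /frame_inv /sqnorm /GRing.scale/=; ring.
Qed.

Lemma rescaled_inv_deriv_gt0 (y : R * R) (s : R) : y != 0 -> 0 < rescaled_inv_deriv y s.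
Proof.
move=> y0; rewrite /rescaled_inv_deriv; have [h1 h2] := frame_invK s y.
have wle := sqnorm_le_inv s y; have ygt := sqnorm_gt0 y y0.
set w := frame_inv s y in h1 h2 wle *.
apply: mulr_gt0; first by rewrite mulr_gt0// exprn_gt0// expR_gt0.
have w0 : 0 < sqnorm w.
  rewrite lt_def sqnorm_ge0 andbT; apply/eqP => w0.
  by move: wle; rewrite w0 mulr0 leNgt ygt.
have d0 : 0 <= delta := le_trans (normr_ge0 _) (frame_deriv_bound HA i0 i0 0).
pose S := `|w.1| + `|w.2|.
have S0 : 0 <= S by rewrite addr_ge0.
have S2 : S ^+ 2 <= 2 * sqnorm w.
  rewrite /sqnorm -(real_normK (num_real w.1)) -(real_normK (num_real w.2)).
  rewrite -subr_ge0 (_ : _ - _ = (`|w.1| - `|w.2|) ^+ 2); last by rewrite /S; ring.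
  exact: sqr_ge0.
have lin (a b : R) (c : R) : `|a| <= c -> `|b| <= c -> `|a * w.1 + b * w.2| <= c * S.
  move=> ac bc; apply: le_trans (ler_normD _ _) _; rewrite !normrM /S mulrDr.
  by apply: lerD; apply: ler_pM.
have y1 : `|y.1| <= M * S by rewrite -h1; apply: lin; exact: (frame_bound HA).
have y2 : `|y.2| <= M * S by rewrite -h2; apply: lin; exact: (frame_bound HA).
have term (a b z1 z2 v : R) : `|a| <= delta -> `|b| <= delta -> `|z1| <= M * S ->
    `|z2| <= M * S -> - (2 * (delta * (M * S)) * `|v|) <= v * (a * z1 - b * z2).
  move=> ad bd z1S z2S; rewrite lerNl -mulrN.
  apply: le_trans (ler_norm _) _; rewrite normrM normrN mulrC; apply: ler_wpM2r => //.
  apply: le_trans (ler_normB _ _) _; rewrite !normrM.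
  have := ler_pM (normr_ge0 _) (normr_ge0 _) ad z1S.
  have := ler_pM (normr_ge0 _) (normr_ge0 _) bd z2S; lra.
have t1 := term _ _ _ _ w.1 (frame_deriv_bound HA i1 i1 s) (frame_deriv_bound HA i0 i1 s) y1 y2.
have t2 := term _ _ _ _ w.2 (frame_deriv_bound HA i0 i0 s) (frame_deriv_bound HA i1 i0 s) y2 y1.
have tt : - (4 * (M * delta) * sqnorm w) <=
    - (2 * (delta * (M * S)) * `|w.1|) - (2 * (delta * (M * S)) * `|w.2|).
  rewrite -opprD lerN2 -mulrDr -/S.
  rewrite (_ : _ * S = 2 * (M * delta) * S ^+ 2); last by ring.
  rewrite (_ : 4 * _ * _ = 2 * (M * delta) * (2 * sqnorm w)); last by ring.
  by apply: ler_wpM2l => //; rewrite mulr_ge0// mulr_ge0// ltW.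
have u : 4 * (M * delta) * sqnorm w <= 4^-1 * sqnorm w.
  by apply: ler_wpM2r; [exact: sqnorm_ge0|move: Mdelta; lra].
lra.
Qed.

Lemma rescaled_inv_norm_lt (y : R * R) (s t : R) : y != 0 -> s < t ->
  rescaled_inv_norm y s < rescaled_inv_norm y t.
Proof.
move=> y0 st; have dG := is_derive_rescaled_inv_norm y.
have [c _ E] := MVT_segment (ltW st) (fun x _ => dG x)
  (derivable_within_continuous (fun x _ => @ex_derive _ _ _ _ _ _ _ (dG x))).
by rewrite -subr_gt0 E mulr_gt0 ?rescaled_inv_deriv_gt0// subr_gt0.
Qed.

Lemma rescaled_inv_norm_ge1 (y : R * R) (s : R) : y != 0 ->
  exists2 t, s < t & 1 <= rescaled_inv_norm y t.
Proof.
move=> /sqnorm_gt0 y0; pose c := sqnorm y / (4 * M ^+ 2).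
have m0 : 0 < 4 * M ^+ 2 by rewrite mulr_gt0// exprn_gt0.
have c0 : 0 < c by exact: divr_gt0.
exists (Num.max (s + 1) c^-1); first by rewrite lt_max ltrDl ltr01.
set t := Num.max _ _.
have tc : c^-1 <= t by rewrite le_max lexx orbT.
have e1 : 1 + t <= expR t by exact: expR_ge1Dx.
have ci : 0 < c^-1 by rewrite invr_gt0.
have cw : c <= sqnorm (frame_inv t y).
  by rewrite ler_pdivrMr// mulrC; exact: sqnorm_le_inv.
rewrite /rescaled_inv_norm.
apply: (@le_trans _ _ (c * c^-1)); first by rewrite mulfV// gt_eqF.
apply: ler_pM => //; [exact: ltW|exact: ltW|].
have t0 : 0 <= t := le_trans (ltW ci) tc.
apply: le_trans tc _.
by nra.
Qed.

Lemma image_disk_spiral (r : R) : 0 < r ->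
  spiral A @` disk r = [set y | sqnorm (frame_inv (- ln r) y) < r ^+ 2].
Proof.
move=> r0; have er : expR (- ln r) ^+ 2 = (r ^+ 2)^-1.
  by rewrite expRN lnK ?posrE// exprVn.
have r20 : 0 < r ^+ 2 by rewrite exprn_gt0.
have invE y : (rescaled_inv_norm y (- ln r) < 1) = (sqnorm (frame_inv (- ln r) y) < r ^+ 2).
  by rewrite /rescaled_inv_norm er ltr_pdivrMr// mul1r.
have spiral0 : spiral A 0 = 0 by rewrite /spiral /spiral_coord/= !mulr0 addr0.
have inv0 s : frame_inv s 0 = 0 by rewrite /frame_inv/= !mulr0 subr0.
have sq0 : sqnorm (0 : R * R) = 0 by rewrite /sqnorm/= expr0n addr0.
apply/seteqP; split => [_ [x /(disk_sqnorm _ _ r0) xr <-]|y] /=.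
  have [->|x0] := eqVneq x 0; first by rewrite spiral0 inv0 sq0.
  have Ax0 : spiral A x != 0.
    apply/eqP => Ax; move/eqP: x0; apply.
    by rewrite -(frame_inv_spiral x) Ax inv0.
  have N1 : rescaled_inv_norm (spiral A x) (logr x) = 1.
    by rewrite /rescaled_inv_norm frame_inv_spiral mulrC expR_logr.
  rewrite -invE -N1; apply: rescaled_inv_norm_lt => //.
  rewrite -ltr_expR -(ltr_pXn2r (n := 2)) ?nnegrE ?expR_ge0//.
  have s0 := sqnorm_gt0 _ x0.
  rewrite er -(ltr_pM2r s0) expR_logr// mulrC ltr_pdivrMr// mul1r.
  exact: xr.
rewrite -invE => Nr.
have [->|y0] := eqVneq y 0.
  by exists 0 => //; apply/disk_sqnorm => //; rewrite sq0.
have [t rt Nt] := rescaled_inv_norm_ge1 y (- ln r) y0.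
have dG := is_derive_rescaled_inv_norm y.
have [||s] := @IVT R (rescaled_inv_norm y) (- ln r) t 1 (ltW rt).
- by apply: derivable_within_continuous => x _; exact: ex_derive.
- by rewrite ge_min le_max (ltW Nr) Nt orbT.
rewrite in_itv/= => /andP[rs st] Ns.
have xs : logr (frame_inv s y) = s by apply: logr_expR; rewrite mulrC.
exists (frame_inv s y); last first.
  have [h1 h2] := frame_invK s y.
  by rewrite /spiral /spiral_coord xs h1 h2 -surjective_pairing.
have rs' : - ln r < s.
  by rewrite lt_neqAle rs andbT; apply/eqP => rsE; move: Nr; rewrite rsE Ns ltxx.
apply/disk_sqnorm => //.
have e_s : (r ^+ 2)^-1 < expR s ^+ 2.
  by rewrite -er ltr_pXn2r ?nnegrE ?expR_ge0// ltr_expR.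
have es0 : 0 < expR s ^+ 2 by rewrite exprn_gt0// expR_gt0.
have E : sqnorm (frame_inv s y) * expR s ^+ 2 = 1 by exact: Ns.
by rewrite -(ltr_pM2r es0) E mulrC -ltr_pdivrMr// mul1r.
Qed.

Lemma measurable_disk (r : R) :
  measurable (disk r : set (measurableTypeR R * measurableTypeR R)).
Proof.
have [r0|r0] := leP r 0.
  rewrite (_ : disk r = set0); first exact: measurable0.
  by rewrite -subset0 => x /= xr; have := sqrtr_ge0 (x.1 ^+ 2 + x.2 ^+ 2);
    rewrite leNgt (lt_le_trans xr).
rewrite (_ : disk r = sqnorm @^-1` `]-oo, r ^+ 2[%classic).
  apply: open_measurable2; apply: open_comp => [x _|]; first exact: continuous_sqnorm.
  exact: interval_open.
by apply/seteqP; split => x; rewrite /= in_itv/= => /(disk_sqnorm _ _ r0).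
Qed.

Lemma fine_lebesgue2_disk1_gt0 : 0 < fine (lebesgue2 R (disk 1)).
Proof.
apply: fine_gt0; apply/andP; split.
  apply: (@lt_le_trans _ _ (lebesgue2 R (box 2^-1))).
    rewrite [ltRHS]product_measure1E//= !lebesgue_measure_itv/= lte_fin.
    rewrite (_ : (- 2^-1 < 2^-1)%R); last by lra.
    by rewrite -EFinB -EFinM lte_fin; lra.
  apply: le_measure; rewrite ?inE; [exact: measurable_box|exact: measurable_disk|].
  move=> x [] /=; rewrite !in_itv/= => /andP[? ?] /andP[? ?].
  by apply/disk_sqnorm => //; rewrite /sqnorm; nra.
apply: le_lt_trans (lebesgue2_box 1).
apply: le_measure; rewrite ?inE; [exact: measurable_disk|exact: measurable_box|].
move=> x /(disk_sqnorm _ _ ltr01); rewrite /sqnorm expr1n => x1.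
by split; rewrite /= in_itv/=; apply/andP; split; nra.
Qed.

Lemma lebesgue2_image_disk (r : R) : 0 < r ->
  lebesgue2 R (spiral A @` disk r) = ((r ^+ 2)%:E * lebesgue2 R (disk 1))%E.
Proof.
move=> r0; rewrite image_disk_spiral//; set s := - ln r.
have d := frame_det HA s.
pose a := A i0 i1 s ^+ 2 + A i0 i0 s ^+ 2.
pose b := - (A i1 i1 s * A i0 i1 s + A i0 i0 s * A i1 i0 s).
have a0 : 0 < a.
  rewrite lt_def addr_ge0 ?sqr_ge0// andbT; apply/eqP => a0.
  move/eqP: a0; rewrite paddr_eq0 ?sqr_ge0// !sqrf_eq0 => /andP[/eqP e1 /eqP e2].
  by move: d; rewrite e1 e2 !mul0r subrr => /eqP; rewrite eq_sym oner_eq0.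
pose k := Num.sqrt a.
have k0 : 0 < k by rewrite sqrtr_gt0.
have k2 : k ^+ 2 = a by rewrite sqr_sqrtr// ltW.
have kn0 : k != 0 by rewrite gt_eqF.
have rn0 : r != 0 by rewrite gt_eqF.
pose c := A i1 i1 s ^+ 2 + A i1 i0 s ^+ 2.
have cE : c = (1 + b ^+ 2) / k ^+ 2.
  rewrite k2; apply: (canRL (mulfK _)); first by rewrite gt_eqF.
  by rewrite -(expr1n _ 2) -d /a /b /c; ring.
have -> : [set y | sqnorm (frame_inv s y) < r ^+ 2] =
    [set y | disk 1 ((r * k)^-1 * y.1, k / r * y.2 + b / (k * r) * y.1)].
  have E y : sqnorm ((r * k)^-1 * y.1, k / r * y.2 + b / (k * r) * y.1) * r ^+ 2 =
      sqnorm (frame_inv s y).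
    transitivity (c * y.1 ^+ 2 + 2 * b * (y.1 * y.2) + k ^+ 2 * y.2 ^+ 2).
      by rewrite cE /sqnorm/=; field; rewrite kn0 rn0.
    by rewrite k2 /c /b /a /sqnorm /frame_inv/=; ring.
  have r2 : 0 < r ^+ 2 by rewrite exprn_gt0.
  apply/seteqP; split => y /=; rewrite -E.
    by move=> h; apply/disk_sqnorm => //; rewrite expr1n -(ltr_pM2r r2) mul1r.
  by move=> /(disk_sqnorm _ _ ltr01); rewrite expr1n -(ltr_pM2r r2) mul1r.
have al0 : 0 < (r * k)^-1 by rewrite invr_gt0 mulr_gt0.
have be0 : 0 < k / r by exact: divr_gt0.
rewrite lebesgue2_linear//; last exact: measurable_disk.
by congr (_%:E * _)%E; field; rewrite kn0 rn0.
Qed.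

Lemma rho_spiral (r : R) : 0 < r -> rho (spiral A) r = r.
Proof.
move=> r0; have d0 := fine_lebesgue2_disk1_gt0.
rewrite /rho lebesgue2_image_disk// fineM//; last first.
  rewrite ge0_fin_numE//; move: d0.
  by case: (lebesgue2 R (disk 1)) => [u _|/=|/=]; rewrite ?ltry ?ltxx.
by rewrite /= mulfK ?gt_eqF// sqrtr_sqr gtr0_norm.
Qed.

Lemma rescale_spiral (t : R) (x : R * R) : 0 < t -> x != 0 ->
  rescale (spiral A) t x =
  (A i0 i0 (logr x - ln t) * x.1 + A i0 i1 (logr x - ln t) * x.2,
   A i1 i0 (logr x - ln t) * x.1 + A i1 i1 (logr x - ln t) * x.2).
Proof.
move=> t0 x0.
have logt : logr (t *: x) = logr x - ln t.
  rewrite /logr (_ : sqnorm _ = t ^+ 2 * sqnorm x); last first.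
    by rewrite /sqnorm/= /GRing.scale/=; ring.
  have tt : 0 < t ^+ 2 by rewrite exprn_gt0.
  rewrite lnM ?posrE//; last exact: sqnorm_gt0.
  by rewrite lnXn// -mulr_natl; field.
have spiral0 : spiral A 0 = 0 by rewrite /spiral /spiral_coord/= !mulr0 addr0.
rewrite /rescale rho_spiral// spiral0 subr0 /spiral /spiral_coord logt.
rewrite /GRing.scale/=; congr (_, _); rewrite /GRing.scale/=; field; exact: lt0r_neq0.
Qed.

Lemma rescale_spiral0 (t : R) : rescale (spiral A) t 0 = 0.
Proof. by rewrite /rescale scaler0 subrr scaler0. Qed.

Lemma frame_lipschitz (S e : R) (i j : 'I_2) : 0 <= e ->
  (forall s, S <= s -> `|A' i j s| <= e) ->
  forall s t, S <= s -> S <= t -> `|A i j s - A i j t| <= e * `|s - t|.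
Proof.
move=> e0 Se.
suff H s t : S <= s -> s <= t -> `|A i j t - A i j s| <= e * `|t - s|.
  move=> s t Ss St; have [st|/ltW ts] := leP s t; last exact: H.
  by rewrite distrC (distrC s); exact: H.
move=> Ss st; have dA := frame_derive HA i j.
have [c cst ->] := MVT_segment st (fun x _ => dA x)
  (derivable_within_continuous (fun x _ => @ex_derive _ _ _ _ _ _ _ (dA x))).
rewrite normrM ler_wpM2r// Se//; move: cst; rewrite in_itv/= => /andP[sc _].
exact: le_trans sc.
Qed.

Lemma frame_shift_cvg (k : nat -> nat) (B : 'I_2 -> 'I_2 -> R) :
  (forall n, (k n < k n.+1)%N) ->
  (forall i j, A i j (k n)%:R @[n --> \oo] --> B i j) ->
  forall e r : R, 0 < e -> exists N, forall n, (N <= n)%N ->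
    forall z, z != 0 -> box r z -> forall i j,
      `|A i j (logr z + (k n)%:R) - B i j| * `|Defs.coord z j| <= e.
Proof.
move=> kinc kB e r0 e0; pose r := Num.max r0 1.
have r1 : 1 <= r by rewrite le_max lexx orbT.
have rgt : 0 < r by exact: lt_le_trans r1.
pose eta := e / (4 * M).
have eta0 : 0 < eta by rewrite divr_gt0// mulr_gt0.
pose L := `|ln (2 * r ^+ 2)| + `|ln (eta ^+ 2)|.
have L0 : 0 <= L by rewrite addr_ge0.
pose e1 := e / (2 * r * (L + 1)).
have e10 : 0 < e1 by rewrite divr_gt0// mulr_gt0 ?mulr_gt0// ltr_wpDl.
have [S HS] := frame_slow HA e1 e10.
have kn n : (n <= k n)%N by elim: n => // n IH; exact: leq_ltn_trans (kinc n).
have er0 : 0 < e / (2 * r) by rewrite divr_gt0// mulr_gt0.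
have : \forall n \near \oo, forall i j, `|B i j - A i j (k n)%:R| <= e / (2 * r).
  have nearij i j : \forall n \near \oo, `|B i j - A i j (k n)%:R| <= e / (2 * r).
    by move/cvgrPdist_le: (kB i j); apply.
  near=> n => i j.
  by case: (ord2P i) => ->; case: (ord2P j) => ->; near: n; exact: nearij.
move=> [N1 _ HN1]; pose N2 := (Num.truncn (`|S| + L)).+1.
exists (maxn N1 N2) => n; rewrite geq_max => /andP[/HN1/= nB nN2] z z0 zr i j.
have kS : S + L <= (k n)%:R.
  apply: (@le_trans _ _ N2%:R); last by rewrite ler_nat (leq_trans nN2).
  by apply: ltW; apply: le_lt_trans (truncnS_gt _); rewrite lerD2r ler_norm.
have [z1 z2] : `|z.1| <= r /\ `|z.2| <= r.
  by move: zr => [] /=; rewrite !in_itv/= -!ler_norml => h1 h2; rewrite !le_max h1 h2.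
have zj : `|Defs.coord z j| <= r by rewrite /Defs.coord; case: (j == i0).
set a := A i j (logr z + _).
rewrite (_ : a - B i j = (a - A i j (k n)%:R) - (B i j - A i j (k n)%:R)); last by ring.
apply: (@le_trans _ _ (`|a - A i j (k n)%:R| * `|Defs.coord z j| + (e / (2 * r)) * r)).
  apply: (@le_trans _ _ ((`|a - A i j (k n)%:R| + `|B i j - A i j (k n)%:R|) * `|Defs.coord z j|)).
    by apply: ler_wpM2r => //; exact: ler_normB.
  rewrite mulrDl lerD2l; apply: ler_pM => //; exact: nB.
have -> : (e / (2 * r)) * r = e / 2 by field; rewrite gt_eqF.
suff : `|a - A i j (k n)%:R| * `|Defs.coord z j| <= e / 2 by lra.
have [zeta|zeta] := leP `|Defs.coord z j| eta.
  have h : `|a - A i j (k n)%:R| <= 2 * M.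
    apply: le_trans (ler_normB _ _) _.
    have := frame_bound HA i j (logr z + (k n)%:R); have := frame_bound HA i j (k n)%:R.
    rewrite -/a; lra.
  apply: le_trans (ler_pM (normr_ge0 _) (normr_ge0 _) h zeta) _.
  by rewrite le_eqVlt; apply/orP; left; apply/eqP; rewrite /eta; field; rewrite gt_eqF.
have sq_le : sqnorm z <= 2 * r ^+ 2.
  rewrite /sqnorm -(real_normK (num_real z.1)) -(real_normK (num_real z.2)).
  have := normr_ge0 z.1; have := normr_ge0 z.2; nra.
have sq_ge : eta ^+ 2 <= sqnorm z.
  rewrite /sqnorm; move: zeta; rewrite /Defs.coord; case: (j == i0) => zeta.
    rewrite -(real_normK (num_real z.1)); have := sqr_ge0 z.2; nra.
  rewrite -(real_normK (num_real z.2)); have := sqr_ge0 z.1; nra.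
have logL : `|logr z| <= L.
  have s0 := sqnorm_gt0 z z0.
  have h1 : ln (sqnorm z) <= ln (2 * r ^+ 2).
    by rewrite ler_ln ?posrE// mulr_gt0// exprn_gt0.
  have h2 : ln (eta ^+ 2) <= ln (sqnorm z).
    by rewrite ler_ln ?posrE// exprn_gt0.
  have := ler_norm (ln (2 * r ^+ 2)); have := ler_norm (- ln (eta ^+ 2)).
  rewrite normrN => h3 h4.
  have h5 : 0 <= `|ln (2 * r ^+ 2)| by [].
  have h6 : 0 <= `|ln (eta ^+ 2)| by [].
  by rewrite /logr ler_norml /L; apply/andP; split; lra.
have lip : `|a - A i j (k n)%:R| <= e1 * L.
  have Sk : S <= (k n)%:R by lra.
  have Sl : S <= logr z + (k n)%:R.
    by move: logL; rewrite ler_norml => /andP[? _]; lra.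
  apply: le_trans (frame_lipschitz S e1 i j (ltW e10) (fun s Ss => HS s Ss i j) _ _ Sl Sk) _.
  by rewrite addrK ler_wpM2l// ltW.
apply: le_trans (ler_pM (normr_ge0 _) (normr_ge0 _) lip zj) _.
have -> : e / 2 = e1 * (L + 1) * r.
  by rewrite /e1; field; rewrite !gt_eqF// ltr_wpDl.
apply: ler_wpM2r; first exact: ltW.
by apply: ler_wpM2l; [exact: ltW|rewrite lerDl].
Unshelve. all: end_near. Qed.

Lemma rescale_spiral_cvg (k : nat -> nat) (B : 'I_2 -> 'I_2 -> R) :
  (forall n, (k n < k n.+1)%N) ->
  (forall i j, A i j (k n)%:R @[n --> \oo] --> B i j) ->
  {family compact, (fun n => rescale (spiral A) (expR (- (k n)%:R))) @ \oo -->
    (fun z : R * R => (B i0 i0 * z.1 + B i0 i1 * z.2, B i1 i0 * z.1 + B i1 i1 * z.2))}.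
Proof.
move=> kinc kB; apply/fam_cvgP => K cK P /uniform_nbhs[E [entE EP]].
move: entE; rewrite -entourage_ballE => -[e /= e0 eE].
have [r Kr] := compact_sub_box _ cK.
have [|N HN] := frame_shift_cvg _ _ kinc kB (e / 4) r; first exact: divr_gt0.
exists N => // n /= Nn; apply: EP => z Kz; apply: eE => /=.
have [->|z0] := eqVneq z 0.
  by rewrite rescale_spiral0/= !mulr0 addr0; exact: ballxx.
rewrite rescale_spiral ?expR_gt0//.
rewrite expRK opprK -ball_normE/= norm_pairE gt_max/=.
have est (i : 'I_2) : `|B i i0 * z.1 + B i i1 * z.2 -
    (A i i0 (logr z + (k n)%:R) * z.1 + A i i1 (logr z + (k n)%:R) * z.2)| < e.
  have h1 := HN n Nn z z0 (Kr z Kz) i i0.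
  have h2 := HN n Nn z z0 (Kr z Kz) i i1.
  rewrite opprD addrACA -!mulrBl.
  apply: le_lt_trans (ler_normD _ _) _; rewrite !normrM ![`|B _ _ - _|]distrC.
  move: h1 h2; rewrite /Defs.coord/=; lra.
by rewrite !est.
Qed.

Lemma infinitesimal_space_spiral : compact X ->
  X = [set phi (1, 0) | phi in infinitesimal_space (spiral A)].
Proof.
move=> cX; have x10 : (1, 0) != 0 :> R * R.
  by rewrite -pair_eqE/= oner_eq0.
have log1 : logr (1, 0) = 0 :> R.
  by rewrite /logr /sqnorm/= expr1n expr0n addr0 ln1 mul0r oppr0.
apply/seteqP; split => [x Xx|x [phi [t [t0 tdec t_cvg phi_cvg]] <-]].
  have [k [B [kinc kB Bx]]] := frame_recurrent HA x Xx.
  exists (fun z : R * R => (B i0 i0 * z.1 + B i0 i1 * z.2, B i1 i0 * z.1 + B i1 i1 * z.2)).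
    exists (fun n => expR (- (k n)%:R)); split.
    - by move=> n; apply: expR_gt0.
    - apply/decreasing_seqP => n; rewrite ltr_expR ltrN2 ltr_nat; exact: kinc.
    - apply/cvgrPdist_le => e e0; exists (Num.truncn e^-1).+1 => // n /= en.
      rewrite sub0r normrN gtr0_norm ?expR_gt0// expRN invf_ple ?posrE ?expR_gt0//.
      apply: le_trans (expR_ge1Dx _); apply: ltW; apply: lt_le_trans (truncnS_gt _) _.
      have kn m : (m <= k m)%N by elim: m => // m IH; exact: leq_ltn_trans (kinc m).
      apply: (@le_trans _ _ n%:R); first by rewrite ler_nat.
      by apply: (@le_trans _ _ (k n)%:R); [rewrite ler_nat|rewrite lerDr].
    - exact: rescale_spiral_cvg.
  by rewrite /= !mulr1 !mulr0 !addr0.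
have phi1 : rescale (spiral A) (t n) (1, 0) @[n --> \oo] --> phi (1, 0).
  by move/fam_cvgP: phi_cvg => /(_ [set (1, 0)]); rewrite uniform_set1;
    apply; exact: compact_set1.
have clX : closed X by apply: compact_closed cX; exact: norm_hausdorff.
apply: contrapT => nX.
have /nbhs_ballP[e /= e0 eX] : nbhs (phi (1, 0)) (~` X).
  by apply: open_nbhs_nbhs; split => //; exact: closed_openC.
have e20 : 0 < e / 2 by exact: divr_gt0.
have [S HS] := frame_near HA _ e20.
have [n [tS tphi]] : exists n, t n <= expR (- S) /\
    `|phi (1, 0) - rescale (spiral A) (t n) (1, 0)| < e / 2.
  have near_t : \forall n \near \oo, t n <= expR (- S).
    have eS : 0 < expR (- S) by apply: expR_gt0.
    move/cvgrPdist_le: t_cvg => /(_ _ eS); apply: filterS => n.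
    by rewrite sub0r normrN gtr0_norm.
  move/cvgrPdist_lt: phi1 => /(_ _ e20) near_phi.
  by have [n []] := @filter_ex _ \oo _ _ (filterI near_t near_phi); exists n.
have [|z Xz zn] := HS (- ln (t n)).
  by rewrite lerNr -ler_expR lnK ?posrE// t0.
apply: (eX z) => //; rewrite -ball_normE/=.
rewrite (_ : phi (1, 0) - z = (phi (1, 0) - rescale (spiral A) (t n) (1, 0)) -
   (z - rescale (spiral A) (t n) (1, 0))); last by rewrite opprB addrA subrK.
apply: le_lt_trans (ler_normB _ _) _.
move: zn tphi; rewrite (rescale_spiral)// log1 sub0r/= !mulr1 !mulr0 !addr0.
lra.
Qed.

End disk_image.

Theorem theorem2p12 (R : realType) (X : set (R * R))
    (X_subset : X `<=` ~` [set 0]) (X_nonempty : X !=set0)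
    (X_compact : compact X) (X_connected : connected X) :
  exists f : R * R -> R * R,
    [/\ quasiregular f,
        ~ (exists c, forall x, f x = c) &
        X = [set phi (1, 0) | phi in infinitesimal_space f]].
Proof.
have [M M0 frames] := exists_slow_frame X X_subset X_nonempty X_compact X_connected.
pose delta := Num.min 1 (16 * M)^-1.
have M16 : 0 < 16 * M by rewrite mulr_gt0.
have delta0 : 0 < delta by rewrite lt_min ltr01 invr_gt0.
have delta1 : delta <= 1 by rewrite ge_min lexx.
have Mdelta : 16 * (M * delta) <= 1.
  rewrite mulrA mulrC -ler_pdivlMr// mul1r.
  by rewrite ge_min lexx orbT.
have [A [A' HA]] := frames delta delta0.
exists (spiral A); split.
- exact: quasiregular_spiral M0 delta1 Mdelta HA.
- move=> [c Ac]; have := Ac (1, 0); rewrite -(Ac 0) => -[].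
  rewrite /spiral_coord/= !mulr0 !mulr1 !addr0 => a0 c0.
  have := frame_det HA (logr (1, 0)).
  by rewrite a0 c0 mul0r mulr0 subrr => /eqP; rewrite eq_sym oner_eq0.
- exact: infinitesimal_space_spiral M0 Mdelta HA X_compact.
Qed.
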